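(* Let $Z^*=(Z,Z_0,\{\Phi_\lambda\}_{\lambda\in\Lambda})$ be a connected finite one-dimensional CW complex with a fixed cellular structure. Let $k:Z\times Z\to\mathbb{R}$ be a continuous kernel that is four-times differentiable on $Z^*$ and satisfies $J(Z,d_k)<\infty$. Let $f:Z\to\mathbb{R}$ be a function in the RKHS of $k$. Let $\mathbf{a}=(a_1,a_2,\dots)$ be a sequence in $Z$ which is dense in $Z$, and let $\mathbf{a}_n$ denote its first $n$ terms. Let $\hat f_n=\hat f_n(\cdot,\mathbf{a}_n,f)$ denote the Gaussian smoothing of $f$ based on observations $y_i=f(a_i)+\zeta_i$, $i=1,\dots,n$, using the kernel $k$, where the $\zeta_i\sim\mathcal{N}(0,\sigma^2)$ are i.i.d. for some $\sigma>0$. Then $$\mathbb{E}\left[\left\|\hat f_n(t,\mathbf{a}_n,f)-f(t)\right\|_\infty\right]\to 0\quad\text{as } n\to\infty.$$ Moreover, for each $\lambda\in\Lambda$ let $\hat f_{n,\lambda}(t)=\hat f_n(\Phi_\lambda(t))$ and $f_\lambda(t)=f(\Phi_\lambda(t))$ for $t\in[0,1]$. Then $$\mathbb{E}\left[\left|V(\hat f_{n,\lambda})-V(f_\lambda)\right|^2\right]\to 0\quad\text{as } n\to\infty$$ for each $\lambda\in\Lambda$; i.e. on each 1-cell the variation of $\hat f_{n,\lambda}$ converges to the variation of $f_\lambda$ in mean square.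
   Context: A finite one-dimensional CW complex is a space $Z=(Z_0\sqcup\bigsqcup_{\lambda\in\Lambda}[0,1])/\phi$ with $Z_0$ a finite discrete set, $\Lambda$ finite, and $\phi$ a map from the endpoints of the intervals to $Z_0$; $\Phi_\lambda:[0,1]\to Z$ is the map of the $\lambda$-th interval into $Z$. A kernel on a set $Z$ is a symmetric function $k:Z\times Z\to\mathbb{R}$ with $\sum_{i,j}a_ia_jk(x_i,x_j)\ge0$ for all finite families $x_i\in Z$, $a_i\in\mathbb{R}$. Its RKHS is the completion of $\mathrm{span}\{k(\cdot,x):x\in Z\}$ under the inner product induced by $\langle k(\cdot,x),k(\cdot,y)\rangle=k(x,y)$, regarded as a space of functions on $Z$. $K(X',X'')$ denotes the Gram matrix $(k(x'_i,x''_j))_{ij}$. A continuous kernel $k$ is $r$-times differentiable on $Z^*$ if for each $\lambda\in\Lambda$ the map $[0,1]^2\to\mathbb{R}$, $(s,t)\mapsto k(\Phi_\lambda(s),\Phi_\lambda(t))$, is $r$-times continuously differentiable, and for each $\lambda\in\Lambda$, $z\in Z$ the map $[0,1]\to\mathbb{R}$, $s\mapsto k(\Phi_\lambda(s),z)$, is $r$-times continuously differentiable (one-sided limits at boundaries). $d_k(t,s)=\sqrt{k(t,t)+k(s,s)-2k(t,s)}$; $N(Z,\varepsilon,d_k)$ is the minimal number of $d_k$-balls of radius $\varepsilon$ needed to cover $Z$; $J(Z,d_k)=\int_0^\infty\sqrt{\log N(Z,\varepsilon,d_k)}\,d\varepsilon$. The Gaussian smoothing of $f$ on $\mathbf{a}_n$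 with observations $\mathbf{y}=(y_1,\dots,y_n)^T$ is $\hat f_n(t)=K(t,\mathbf{a}_n)\,(K(\mathbf{a}_n,\mathbf{a}_n)+\sigma^2I_n)^{-1}\mathbf{y}$. The expectation is over the noise $\zeta_i$. The variation of $g:[0,1]\to\mathbb{R}$ is $V(g)=\int_0^1|g'(t)|\,dt$. *)

(* Defs.v *)
From HB Require Import structures.
From mathcomp Require Import all_boot all_order all_algebra finmap generic_quotient.
From mathcomp Require Import all_classical all_reals all_analysis.

Set Implicit Arguments.
Unset Strict Implicit.
Unset Printing Implicit Defensive.

Import Order.TTheory GRing.Theory Num.Theory.
Import numFieldNormedType.Exports.

Local Open Scope classical_set_scope.
Local Open Scope ring_scope.

(* [unitI R] is the interval [0, 1] as a type, with the subtype topology. *)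
Notation unitI R := (set_type (`[0%R, 1%R]%classic : set R%type)).

Section unit_interval.
Context {R : realType}.

Lemma in_unitI (t : R) : 0 <= t <= 1 -> t \in (`[0, 1]%classic : set R).
Proof. by move=> t01; apply/mem_set; rewrite /= in_itv. Qed.

Definition zeroI : unitI R := exist _ 0 (in_unitI (introT andP (conj (lexx 0) ler01))).
Definition oneI : unitI R := exist _ 1 (in_unitI (introT andP (conj ler01 (lexx 1)))).

(* Outside [0, 1] the value is junk (0); it is only used on [0, 1]. *)
Definition toI (t : R) : unitI R := insubd zeroI t.

(* Derivatives are limits of difference quotients inside the space [0, 1];
   at 0 and 1 they are therefore the one-sided derivatives. *)
Definition diff_quot (g : unitI R -> R) (t s : unitI R) : R :=
  (g s - g t) / (val s - val t).

Definition is_derivI (g : unitI R -> R) (t : unitI R) (l : R) : Prop :=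
  diff_quot g t @ t^' --> l.

Definition derivI (g : unitI R -> R) (t : unitI R) : R :=
  lim (diff_quot g t @ t^').

Fixpoint C_I (r : nat) (g : unitI R -> R) : Prop :=
  if r is r'.+1 then
    continuous g /\
    exists2 g1 : unitI R -> R, (forall t, is_derivI g t (g1 t)) & C_I r' g1
  else continuous g.

Fixpoint C_II (r : nat) (g : unitI R * unitI R -> R) : Prop :=
  if r is r'.+1 then
    continuous g /\
    exists g1 g2 : unitI R * unitI R -> R,
      [/\ forall s t, is_derivI (fun u => g (u, t)) s (g1 (s, t)),
          forall s t, is_derivI (fun u => g (s, u)) t (g2 (s, t)),
          C_II r' g1 & C_II r' g2]
  else continuous g.

(* The variation is defined by the integral of the absolute value of the
   derivative, not as a supremum over partitions. *)
Definition variationI (g : unitI R -> R) : \bar R :=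
  (\int[lebesgue_measure]_(t in `[0%R, 1%R]) `|derivI g (toI t)|%:E)%E.

End unit_interval.

(* One-dimensional CW complexes: vertex set Z0, cells indexed by L, and an
   attaching map phi, where [phi l false] (resp. [phi l true]) is the vertex to
   which the endpoint 0 (resp. 1) of the l-th interval is attached. *)
Section cw.
Context {R : realType} {Z0 L : finType} (phi : L -> bool -> Z0).

Definition cw_piece (i : option L) : topologicalType :=
  if i is Some _ then unitI R else discrete_topology Z0.

(* The disjoint union of Z0 and of the intervals. *)
Definition cw_pre := {i : option L & cw_piece i}.

Definition pre_vertex (v : Z0) : cw_pre := existT cw_piece None v.
Definition pre_cell (l : L) (t : unitI R) : cw_pre :=
  existT cw_piece (Some l) t.

(* Two points are identified iff they become equal once each endpoint of an
   interval has been replaced by the vertex to which it is attached. *)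
Definition cw_attach (x : cw_pre) : cw_pre :=
  match x with
  | existT None v => pre_vertex v
  | existT (Some l) t =>
      if t == zeroI :> unitI R then pre_vertex (phi l false)
      else if t == oneI :> unitI R then pre_vertex (phi l true)
      else pre_cell l t
  end.

Definition glued (x y : cw_pre) := cw_attach x == cw_attach y.

Lemma cw_rel_refl : reflexive glued.
Proof. by move=> x; exact: eqxx. Qed.

Lemma cw_rel_sym : symmetric glued.
Proof. by move=> x y; exact: eq_sym. Qed.

Lemma cw_rel_trans : transitive glued.
Proof. by move=> y x z /eqP xy /eqP yz; apply/eqP; rewrite xy. Qed.

Definition cw_rel := EquivRel _ cw_rel_refl cw_rel_sym cw_rel_trans.

Definition cw := {eq_quot cw_rel}%qT.

HB.instance Definition _ := Topological.copy cw (quotient_topology cw).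
HB.instance Definition _ := Quotient.on cw.

Definition vertex (v : Z0) : cw := (\pi_cw (pre_vertex v))%qT.
Definition cell (l : L) (t : unitI R) : cw := (\pi_cw (pre_cell l t))%qT.

Lemma cell0 l : cell l zeroI = vertex (phi l false).
Proof. by apply/eqmodP; rewrite /= /glued /= eqxx. Qed.

Lemma cell1 l : cell l oneI = vertex (phi l true).
Proof.
apply/eqmodP; rewrite /= /glued /= eqxx; case: ifP => // /eqP/(congr1 val)/=.
by move/eqP; rewrite oner_eq0.
Qed.

End cw.

Arguments cw R {Z0 L} phi.

Section kernels.
Context {R : realType} {Z : Type}.
Implicit Types (k : Z -> Z -> R).

Definition is_kernel k : Prop :=
  (forall x y, k x y = k y x) /\
  (forall (n : nat) (x : 'I_n -> Z) (a : 'I_n -> R),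
     0 <= \sum_(i < n) \sum_(j < n) a i * a j * k (x i) (x j)).

(* A list [:: (a_1, x_1); ...; (a_m, x_m)] stands for the element
   a_1 k(., x_1) + ... + a_m k(., x_m) of the span. *)
Definition span_fun k (c : seq (R * Z)) (z : Z) : R :=
  \sum_(p <- c) p.1 * k z p.2.

Definition span_dot k (c d : seq (R * Z)) : R :=
  \sum_(p <- c) \sum_(q <- d) p.1 * q.1 * k p.2 q.2.

Definition span_sub (c d : seq (R * Z)) : seq (R * Z) :=
  c ++ [seq (- q.1, q.2) | q <- d].

Definition span_norm k (c : seq (R * Z)) : R := Num.sqrt (span_dot k c c).

(* An element of the completion is represented by a Cauchy sequence (c_n) of
   the span; the function on Z it determines is
   z |-> lim_n <c_n, k(., z)> = lim_n c_n(z). *)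
Definition in_rkhs k (f : Z -> R) : Prop :=
  exists c : nat -> seq (R * Z),
    (forall e : R, 0 < e -> exists N : nat, forall m n : nat,
       (N <= m)%N -> (N <= n)%N -> span_norm k (span_sub (c m) (c n)) < e) /\
    (forall z, (fun n => span_fun k (c n) z) @ \oo --> f z).

Definition dk k (t s : Z) : R := Num.sqrt (k t t + k s s - 2 * k t s).

(* Minimal number of (open) balls; +oo if no finite cover exists. *)
Definition covering_number (dist : Z -> Z -> R) (e : R) : \bar R :=
  ereal_inf [set n%:R%:E | n in
    [set n : nat | exists c : 'I_n -> Z, forall z, exists i, dist (c i) z < e]].

Definition entropy_integral (dist : Z -> Z -> R) : \bar R :=
  (\int[lebesgue_measure]_(e in `]0%R, +oo[) sqrte (lne (covering_number dist e)))%E.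

(* The first n terms of a are a 0, ..., a (n - 1). *)
Definition gram k (a : nat -> Z) (n : nat) : 'M[R]_n :=
  \matrix_(i, j) k (a i) (a j).

Definition gaussian_smoothing k (sigma : R) (a : nat -> Z) (n : nat)
    (y : nat -> R) (t : Z) : R :=
  ((\row_(j < n) k t (a j)) *m invmx (gram k a n + (sigma ^+ 2)%:M)
     *m (\col_(i < n) y i)) 0 0.

Definition sup_norm (g : Z -> R) : \bar R :=
  ereal_sup (range (fun z => `|g z|%:E)).

End kernels.

Definition kernel_differentiable (R : realType) (Z0 L : finType)
    (phi : L -> bool -> Z0) (r : nat) (k : cw R phi -> cw R phi -> R) : Prop :=
  (forall l, C_II r (fun p => k (cell phi l p.1) (cell phi l p.2))) /\
  (forall l z, C_I r (fun s => k (cell phi l s) z)).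

Section noise.
Context {R : realType} {d : measure_display} {T : measurableType d}.

(* Product rule over every finite subfamily. *)
Definition mutually_independent (P : probability T R)
    (X : nat -> {RV P >-> R}) : Prop :=
  forall (J : {fset nat}) (A : nat -> set R),
    (forall i, measurable (A i)) ->
    (P (\bigcap_(i in [set` J]) (X i @^-1` A i))
     = \prod_(i <- J) P (X i @^-1` A i))%E.

Definition iid_normal (P : probability T R) (m s : R)
    (X : nat -> {RV P >-> R}) : Prop :=
  mutually_independent X /\
  (forall i (A : set R), measurable A ->
     distribution P (X i) A = normal_prob m s A).

End noise.

(* Main.v *)
Require Import Defs.
From HB Require Import structures.
From mathcomp Require Import all_boot all_order all_algebra.
From mathcomp Require Import finmap generic_quotient.
From mathcomp Require Import all_classical all_reals all_analysis.
From mathcomp Require Import measurable_realfun ring lra.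

(** Smoothing is ridge regression in the kernel space. For a functional u, a
finite combination of point evaluations, the smoothed value of u is
sum_i w_i(u) y_i, where the weights w(u) minimize the cost

  cost(u, b) = || u - sum_i b_i delta_(a_i) ||^2 + sigma^2 |b|^2

over all b, the norm being the one dual to the kernel space
([weight_cost_min]). At the minimum the first summand controls the squared
bias, because f is a bounded functional of u, and the second is the variance of
the noise. Hence the mean squared error at u is at most a constant times
cost(u, b) for whichever b one chooses to test with ([error_cost_le]).

To bound it at a point z, take for b the average over many samples close to z:
the first summand is small by continuity of the kernel, the penalty is
sigma^2 / m for m samples ([cost_average], [point_cost_small]). There are
arbitrarily many samples near z since the complex is connected and T1
([dense_seq_infinitely_often]). Compactness of the cells makes this uniform.

The derivative along a cell is handled in the same way. By two applications of
the mean value theorem, the inner product of two difference quotients of point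
evaluations is a value of the mixed second derivative of the kernel, so the
quotients form a uniformly Cauchy family ([slope_uniform_cauchy]). It follows
that functions of the kernel space are C^1 on the cells ([rkhs_bounded_C1]).
It follows also that the derivative at t is predicted almost as well as a
difference quotient of a fixed small width, which involves only two points
([slope_cost_small]). So the mean squared error of the derivative tends to zero
uniformly along each cell ([derivative_error_small]).

Both conclusions follow. Write g for the error at step n, and g_l for its
restriction to the cell l. Then g is bounded by the sum of its absolute values
at the vertices and of the integrals of |g_l'|, and the squared difference of
the variations on a cell is at most the integral of g_l'^2. By Tonelli's theorem
the expectations of these quantities are integrals of the pointwise mean squared
errors ([expected_cell_energy_le]). The latter are computed from the facts that
the noise is centred, uncorrelated and of finite variance
([affine_noise_second_moment]). *)

Set Implicit Arguments.
Unset Strict Implicit.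
Unset Printing Implicit Defensive.

Import Order.TTheory GRing.Theory Num.Theory.
Import numFieldNormedType.Exports.

Local Open Scope classical_set_scope.
Local Open Scope ring_scope.


(** * Bounded functionals and the cost of ridge regression *)

Section functionals.
Context {R : realType} {Z : Type}.
Implicit Types (u v w : seq (R * Z)) (g h : Z -> R).

(** A list in the span is read as the combination of point evaluations with the
same coefficients. Different lists may give the same functional, so linear
relations between functionals are stated as identities of ev g for all g. *)
Definition ev g u : R := \sum_(p <- u) p.1 * g p.2.

Lemma ev_cat g u v : ev g (u ++ v) = ev g u + ev g v.
Proof. by rewrite /ev big_cat. Qed.

Lemma ev_cons g p u : ev g (p :: u) = p.1 * g p.2 + ev g u.
Proof. by rewrite /ev big_cons. Qed.

Lemma ev_nil g : ev g [::] = 0.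
Proof. by rewrite /ev big_nil. Qed.

Lemma ev_sub g u v : ev g (span_sub u v) = ev g u - ev g v.
Proof.
rewrite /span_sub ev_cat; congr (_ + _); rewrite /ev big_map -sumrN.
by apply: eq_bigr => p _; rewrite mulNr.
Qed.

Lemma ev_eqf g h u : g =1 h -> ev g u = ev h u.
Proof. by move=> gh; apply: eq_bigr => p _; rewrite gh. Qed.

Lemma ev_sumf (I : Type) (r : seq I) (c : I -> R) (G : I -> Z -> R) u :
  ev (fun z => \sum_(i <- r) c i * G i z) u = \sum_(i <- r) c i * ev (G i) u.
Proof.
rewrite /ev; under eq_bigr => p _ do rewrite mulr_sumr.
rewrite exchange_big/=; apply: eq_bigr => i _; rewrite mulr_sumr.
by apply: eq_bigr => p _; rewrite mulrCA.
Qed.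

End functionals.

Section form.
Context {R : realType} {Z : Type} (k : Z -> Z -> R) (kker : is_kernel k).
Implicit Types (u v w : seq (R * Z)) (g h : Z -> R).

Local Notation dot := (span_dot k).
Local Notation sqn u := (span_dot k u u).

Lemma span_dotE u v : dot u v = ev (span_fun k v) u.
Proof.
rewrite /span_dot /ev; apply: eq_bigr => p _.
by rewrite mulr_sumr; apply: eq_bigr => q _; rewrite mulrA.
Qed.

Lemma span_funE u z : span_fun k u z = ev (k z) u. Proof. by []. Qed.

Lemma span_dotC u v : dot u v = dot v u.
Proof.
rewrite /span_dot exchange_big/=; apply: eq_bigr => p _.
by apply: eq_bigr => q _; rewrite (kker.1 q.2) (mulrC q.1).
Qed.

Lemma sqn_ge0 u : 0 <= sqn u.
Proof.
have := kker.2 (size u) (fun i => (tnth (in_tuple u) i).2)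
  (fun i => (tnth (in_tuple u) i).1).
rewrite /span_dot.
suff -> : \sum_(p <- u) \sum_(q <- u) p.1 * q.1 * k p.2 q.2 =
  \sum_(i < size u) \sum_(j < size u) (tnth (in_tuple u) i).1 *
    (tnth (in_tuple u) j).1 * k (tnth (in_tuple u) i).2 (tnth (in_tuple u) j).2.
  by [].
rewrite big_tnth; apply: eq_bigr => i _.
by rewrite big_tnth; apply: eq_bigr => j _.
Qed.

(** The form only sees the functional represented by a list, so it can be
expanded along any linear relation between functionals. *)
Lemma span_dot_linl (a b : R) u v w x :
  (forall g, ev g w = a * ev g u + b * ev g v) ->
  dot w x = a * dot u x + b * dot v x.
Proof. by move=> wE; rewrite !span_dotE wE. Qed.

Lemma sqn_lin (a b : R) u v w :
  (forall g, ev g w = a * ev g u + b * ev g v) ->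
  sqn w = a ^+ 2 * sqn u + 2 * a * b * dot u v + b ^+ 2 * sqn v.
Proof.
move=> wE; rewrite (span_dot_linl _ wE) (span_dotC u w) (span_dotC v w).
by rewrite !(span_dot_linl _ wE) (span_dotC v u); ring.
Qed.

Lemma sqn_add_le u v w : (forall g, ev g w = ev g u + ev g v) ->
  sqn w <= 2 * sqn u + 2 * sqn v.
Proof.
move=> wE; rewrite (@sqn_lin 1 1 u v); last by move=> g; rewrite !mul1r.
have := sqn_ge0 (span_sub u v); rewrite (@sqn_lin 1 (-1) u v).
  by lra.
by move=> g; rewrite ev_sub mul1r mulN1r.
Qed.

Lemma span_dot_CS u v : dot u v ^+ 2 <= sqn u * sqn v.
Proof.
have P t : 0 <= sqn u + 2 * t * dot u v + t ^+ 2 * sqn v.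
  have := sqn_ge0 (u ++ [seq (t * p.1, p.2) | p <- v]).
  rewrite (@sqn_lin 1 t u v) ?expr1n ?mul1r ?mulr1//.
  move=> g; rewrite ev_cat mul1r; congr (_ + _).
  by rewrite /ev big_map mulr_sumr; apply: eq_bigr => p _; rewrite mulrA.
have [v0|v0] := eqVneq (sqn v) 0.
  have [->|uv0] := eqVneq (dot u v) 0.
    by rewrite expr0n/= mulr_ge0 ?sqn_ge0.
  have := P (- (sqn u + 1) / (2 * dot u v)); rewrite v0 mulr0 addr0.
  have -> : 2 * (- (sqn u + 1) / (2 * dot u v)) * dot u v = - (sqn u + 1).
    by field.
  by lra.
have vp : 0 < sqn v by rewrite lt_def v0 sqn_ge0.
have := P (- dot u v / sqn v).
have -> : sqn u + 2 * (- dot u v / sqn v) * dot u v +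
    (- dot u v / sqn v) ^+ 2 * sqn v = (sqn u * sqn v - dot u v ^+ 2) / sqn v.
  by field.
by rewrite pmulr_lge0 ?invr_gt0// subr_ge0.
Qed.

(** By the reproducing property ev f u is the inner product of f and u, so it is
bounded by the norms; M stands for the squared norm of f. *)
Definition rkhs_bounded (M : R) (f : Z -> R) : Prop :=
  0 <= M /\ forall u, ev f u ^+ 2 <= M * sqn u.

Lemma span_fun_bounded v : rkhs_bounded (sqn v) (span_fun k v).
Proof.
split=> [|u]; first exact: sqn_ge0.
by rewrite -span_dotE mulrC span_dot_CS.
Qed.

(** The bound passes from the approximating span functions, whose norms stay
bounded along a Cauchy sequence, to their pointwise limit. *)
Lemma in_rkhs_bounded f : in_rkhs k f -> exists M, rkhs_bounded M f.
Proof.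
case=> c [cC cf].
have [N cN] := cC 1 ltr01.
exists (2 + 2 * sqn (c N)); split=> [|u].
  by rewrite addr_ge0 ?mulr_ge0 ?sqn_ge0.
have cB n : (N <= n)%N -> sqn (c n) <= 2 + 2 * sqn (c N).
  move=> Nn; have := cN n N Nn (leqnn N); rewrite /span_norm => h.
  have d1 : sqn (span_sub (c n) (c N)) <= 1.
    rewrite -(ler_sqrt _ (ler01)) sqrtr1; exact: ltW.
  have := @sqn_add_le (span_sub (c n) (c N)) (c N) (c n).
  have H g : ev g (c n) = ev g (span_sub (c n) (c N)) + ev g (c N).
    by rewrite ev_sub subrK.
  by move=> /(_ H); lra.
have cvu : (fun n => ev (span_fun k (c n)) u) @ \oo --> ev f u.
  rewrite /ev; apply: cvg_big => [|p _]; first exact: add_continuous.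
  by apply: cvgM; [exact: cvg_cst|exact: cf].
have cvu2 : (fun n => ev (span_fun k (c n)) u ^+ 2) @ \oo --> ev f u ^+ 2.
  by rewrite expr2; under eq_fun do rewrite expr2; exact: cvgM.
apply: (cvgr_to_le cvu2).
exists N => // n /= Nn; apply: (le_trans ((span_fun_bounded (c n)).2 u)).
by rewrite ler_wpM2r ?sqn_ge0// cB.
Qed.

End form.

Section smoothing.
Context {R : realType} {Z : Type} (k : Z -> Z -> R) (kker : is_kernel k).
Variables (sigma : R) (sigma_gt0 : 0 < sigma) (a : nat -> Z) (n : nat).
Implicit Types (u v w : seq (R * Z)) (b c : 'I_n -> R).

Local Notation sqn u := (span_dot k u u).
Local Notation A := (gram k a n + (sigma ^+ 2)%:M).

Definition samples b : seq (R * Z) := [seq (b i, a i) | i <- enum 'I_n].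

Lemma ev_samples g b : ev g (samples b) = \sum_i b i * g (a i).
Proof. by rewrite /ev big_map big_enum. Qed.

(** A vector in the kernel of the regularized Gram matrix annihilates its
quadratic form, which dominates sigma^2 times the squared length. *)
Lemma regularized_gram_unit : A \in unitmx.
Proof.
rewrite unitmxE unitfE; apply/det0P => -[v v0 vA].
have : (v *m A *m v^T) 0 0 = sqn (samples (v 0)) + sigma ^+ 2 * \sum_i v 0 i ^+ 2.
  rewrite mulmxDr mulmxDl mxE; congr (_ + _).
    rewrite span_dotE ev_samples mxE; under eq_bigr => j _ do rewrite !mxE mulr_suml.
    rewrite exchange_big/=; apply: eq_bigr => i _.
    rewrite span_funE ev_samples mulr_sumr; apply: eq_bigr => j _.
    by rewrite !mxE; ring.
  rewrite mul_mx_scalar -scalemxAl mxE; congr (_ * _).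
  by rewrite mxE; apply: eq_bigr => i _; rewrite mxE expr2.
rewrite vA mul0mx mxE => /esym/eqP.
rewrite paddr_eq0 ?sqn_ge0//; last first.
  by rewrite mulr_ge0 ?sqr_ge0// sumr_ge0// => i _; rewrite sqr_ge0.
case/andP => _; rewrite mulf_eq0 sqrf_eq0 gt_eqF//= psumr_eq0; last first.
  by move=> i _; rewrite sqr_ge0.
move=> /allP h; move/eqP: v0; apply; apply/rowP => i; rewrite mxE.
by have := h i (mem_index_enum i); rewrite sqrf_eq0 => /eqP.
Qed.

Definition weight (i : 'I_n) (t : Z) : R :=
  ((\row_(j < n) k t (a j)) *m invmx A) 0 i.

Lemma gaussian_smoothingE y t :
  gaussian_smoothing k sigma a n y t = \sum_i weight i t * y i.
Proof.
rewrite /gaussian_smoothing mxE; apply: eq_bigr => i _; congr (_ * _).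
by rewrite mxE.
Qed.

Lemma weight_bounded i : exists M, rkhs_bounded k M (weight i).
Proof.
exists (sqn (samples (fun j => invmx A j i))).
suff -> : weight i = span_fun k (samples (fun j => invmx A j i)).
  exact: span_fun_bounded.
apply/funext => t; rewrite span_funE ev_samples /weight mxE.
by apply: eq_bigr => j _; rewrite mxE mulrC.
Qed.

(** First-order condition for the minimum of the cost. *)
Lemma weight_normal_eq u (j : 'I_n) :
  \sum_i ev (weight i) u * k (a i) (a j) + sigma ^+ 2 * ev (weight j) u
  = span_fun k u (a j).
Proof.
pose G := \row_(j < n) span_fun k u (a j).
have W : \row_i ev (weight i) u = G *m invmx A.
  apply/rowP => i; rewrite !mxE.
  transitivity (ev (fun t => \sum_j invmx A j i * k t (a j)) u).
    by apply: ev_eqf => t; rewrite /weight mxE; apply: eq_bigr => l _;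
      rewrite mxE mulrC.
  rewrite ev_sumf; apply: eq_bigr => l _; rewrite mxE mulrC; congr (_ * _).
  by rewrite span_funE; apply: ev_eqf => t; rewrite kker.1.
have : (\row_i ev (weight i) u *m A) 0 j = G 0 j.
  by rewrite W mulmxKV// regularized_gram_unit.
rewrite [G _ _]mxE => <-; rewrite mulmxDr mxE; congr (_ + _).
  by rewrite mxE; apply: eq_bigr => i _; rewrite !mxE.
by rewrite mul_mx_scalar !mxE.
Qed.

(** The squared prediction error of u by the samples with coefficients b, in the
worst case over the unit ball of the kernel space, plus the noise variance. *)
Definition cost u b : R :=
  sqn (span_sub u (samples b)) + sigma ^+ 2 * \sum_i b i ^+ 2.

Lemma cost_ge0 u b : 0 <= cost u b.
Proof.
by rewrite addr_ge0 ?sqn_ge0// mulr_ge0 ?sqr_ge0// sumr_ge0// => i _;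
  rewrite sqr_ge0.
Qed.

(** The normal equations make the smoothing weights the minimizer: the cross
term in the expansion around them combines with the penalty into a square. *)
Lemma weight_cost_min u b : cost u (fun i => ev (weight i) u) <= cost u b.
Proof.
set w := fun i => ev (weight i) u.
pose D := samples (fun i => w i - b i).
have E g : ev g (span_sub u (samples b)) =
    1 * ev g (span_sub u (samples w)) + 1 * ev g D.
  rewrite !ev_sub !ev_samples !mul1r -addrA; congr (_ + _).
  rewrite -!sumrN -big_split; apply: eq_bigr => i _ /=.
  by rewrite mulrBl addKr.
have X : span_dot k (span_sub u (samples w)) D =
    sigma ^+ 2 * \sum_i (w i - b i) * w i.
  rewrite span_dotC// span_dotE ev_samples mulr_sumr; apply: eq_bigr => j _.
  rewrite span_funE ev_sub ev_samples mulrCA; congr (_ * _).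
  rewrite -[ev _ u]/(span_fun k u (a j)) -weight_normal_eq -/(w j).
  under eq_bigr => i _ do rewrite -/(w i) kker.1.
  by rewrite addrAC subrr add0r.
rewrite /cost (sqn_lin kker E) X.
have D0 := sqn_ge0 kker D.
have Q : \sum_i b i ^+ 2 + 2 * \sum_i (w i - b i) * w i =
    \sum_i w i ^+ 2 + \sum_i (w i - b i) ^+ 2.
  by rewrite mulr_sumr -!big_split; apply: eq_bigr => i _ /=; ring.
have S0 : 0 <= sigma ^+ 2 * \sum_i (w i - b i) ^+ 2.
  by rewrite mulr_ge0 ?sqr_ge0// sumr_ge0// => i _; rewrite sqr_ge0.
rewrite [leRHS](_ : _ = sqn (span_sub u (samples w)) + sqn D +
  sigma ^+ 2 * (\sum_i b i ^+ 2 + 2 * \sum_i (w i - b i) * w i)); last by ring.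
by rewrite Q mulrDr; lra.
Qed.

(** Bias and noise are both controlled by the optimal cost, hence by the cost
of any competitor b. *)
Lemma error_cost_le (M V : R) f u b : rkhs_bounded k M f -> 0 <= V ->
  V * (\sum_i ev (weight i) u ^+ 2)
    + (\sum_i ev (weight i) u * f (a i) - ev f u) ^+ 2
  <= (M + V / sigma ^+ 2) * cost u b.
Proof.
move=> [M0 fM] V0; set w := fun i => ev (weight i) u.
have s0 : 0 < sigma ^+ 2 by rewrite exprn_gt0.
apply: (@le_trans _ _ ((M + V / sigma ^+ 2) * cost u w)); last first.
  by rewrite ler_wpM2l ?weight_cost_min// addr_ge0// divr_ge0// ltW.
(* The bias at u is the value of f at the residual functional. *)
rewrite -sqrrN opprB -ev_samples -ev_sub.
have := fM (span_sub u (samples w)); rewrite /cost.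
have S0 : 0 <= \sum_i w i ^+ 2 by apply: sumr_ge0 => i _; rewrite sqr_ge0.
have N0 := sqn_ge0 kker (span_sub u (samples w)).
have -> : (M + V / sigma ^+ 2) *
   (sqn (span_sub u (samples w)) + sigma ^+ 2 * \sum_i w i ^+ 2) =
   M * sqn (span_sub u (samples w)) + V * \sum_i w i ^+ 2
   + (M * (sigma ^+ 2 * \sum_i w i ^+ 2)
   + V / sigma ^+ 2 * sqn (span_sub u (samples w))).
  by field; rewrite gt_eqF.
have : 0 <= M * (sigma ^+ 2 * \sum_i w i ^+ 2).
  by rewrite !mulr_ge0// ltW.
have : 0 <= V / sigma ^+ 2 * sqn (span_sub u (samples w)).
  by rewrite mulr_ge0// divr_ge0// ltW.
by rewrite -/w; lra.
Qed.

Lemma error_small (M V e : R) f u b : rkhs_bounded k M f -> 0 <= V -> 0 <= e ->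
  cost u b <= e / (M + V / sigma ^+ 2 + 1) ->
  V * (\sum_i ev (weight i) u ^+ 2)
    + (\sum_i ev (weight i) u * f (a i) - ev f u) ^+ 2 <= e.
Proof.
move=> fM V0 e0 ub; apply: le_trans (error_cost_le u b fM V0) _.
have MV0 : 0 <= M + V / sigma ^+ 2.
  by rewrite addr_ge0 ?fM.1// divr_ge0// sqr_ge0.
set C := M + V / sigma ^+ 2 in ub MV0 *.
have C1 : 0 < C + 1 by rewrite ltr_wpDl.
apply: (le_trans (ler_wpM2l MV0 ub)).
by rewrite mulrCA ler_piMr// ler_pdivrMr// mul1r lerDl.
Qed.

(** Replacing a functional by a nearby one that is easier to predict. *)
Lemma cost_shift u v b : cost u b <= 2 * sqn (span_sub u v) + 2 * cost v b.
Proof.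
rewrite /cost; have := @sqn_add_le _ _ k kker (span_sub u v)
  (span_sub v (samples b)) (span_sub u (samples b)).
have H g : ev g (span_sub u (samples b)) =
   ev g (span_sub u v) + ev g (span_sub v (samples b)).
  by rewrite !ev_sub; ring.
move=> /(_ H).
have : 0 <= sigma ^+ 2 * \sum_i b i ^+ 2.
  by rewrite mulr_ge0 ?sqr_ge0// sumr_ge0// => i _; rewrite sqr_ge0.
by lra.
Qed.

(** The prediction of a scaled difference of two points by the scaled difference
of their predictions, with the parallelogram inequality. *)
Lemma cost_difference (c : R) x y b b' :
  cost [:: (c, x); (- c, y)] (fun i => c * (b i - b' i))
  <= 2 * c ^+ 2 * (cost [:: (1, x)] b + cost [:: (1, y)] b').
Proof.
pose u := span_sub [:: (1, x)] (samples b).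
pose v := span_sub [:: (1, y)] (samples b').
rewrite {1}/cost (@sqn_lin _ _ k kker c (- c) u v); last first.
  move=> g; rewrite !ev_sub !ev_cons !ev_nil !ev_samples/=.
  have -> : \sum_i c * (b i - b' i) * g (a i) =
     c * (\sum_i b i * g (a i)) - c * (\sum_i b' i * g (a i)).
    rewrite !mulr_sumr -sumrN -big_split; apply: eq_bigr => i _ /=; ring.
  ring.
have P : 0 <= sqn (u ++ v) by exact: sqn_ge0.
have {}P : 0 <= sqn u + 2 * span_dot k u v + sqn v.
  rewrite (@sqn_lin _ _ k kker 1 1 u v) in P; last first.
    by move=> g; rewrite ev_cat !mul1r.
  by rewrite !expr1n !mul1r !mulr1 in P.
have S : \sum_i (c * (b i - b' i)) ^+ 2 <=
    2 * c ^+ 2 * (\sum_i b i ^+ 2 + \sum_i b' i ^+ 2).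
  rewrite -big_split mulr_sumr; apply: ler_sum => i _ /=.
  have := mulr_ge0 (sqr_ge0 c) (sqr_ge0 (b i + b' i)); nra.
have := ler_wpM2l (sqr_ge0 sigma) S.
have := mulr_ge0 (sqr_ge0 c) P.
rewrite /cost -/u -/v; lra.
Qed.

(** Averaging samples that are mutually close costs little beyond the penalty,
which is the variance of the mean. *)
Lemma cost_average (m : nat) (S : {set 'I_n}) (e K : R) z :
  (0 < m)%N -> #|S| = m ->
  `|k z z - K| <= e -> (forall i, i \in S -> `|k z (a i) - K| <= e) ->
  (forall i j, i \in S -> j \in S -> `|k (a i) (a j) - K| <= e) ->
  cost [:: (1, z)] (fun i => (i \in S)%:R / m%:R) <= 4 * e + sigma ^+ 2 / m%:R.
Proof.
move=> m0 sm kz ki kij.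
have mr : m%:R != 0 :> R by rewrite pnatr_eq0 -lt0n.
have S1 : \sum_i (i \in S)%:R / m%:R = 1 :> R.
  rewrite -mulr_suml -natr_sum (_ : (\sum_i (i \in S))%N = m) ?divff//.
  by rewrite -sm -sum1_card [RHS]big_mkcond; apply: eq_bigr => i _; case: (i \in S).
set b := fun i => (i \in S)%:R / m%:R.
have b0 i : 0 <= b i by rewrite /b divr_ge0 ?ler0n.
apply: lerD; last first.
  rewrite ler_wpM2l ?sqr_ge0//.
  have -> : \sum_i b i ^+ 2 = (\sum_i b i) / m%:R.
    rewrite mulr_suml; apply: eq_bigr => i _; rewrite /b expr2.
    by case: (i \in S); rewrite ?mul0r//= mul1r.
  by rewrite S1 mul1r.
(* The coefficients sum to 1, so the residual is an average of differences
   of point evaluations; its squared norm is an average of second differences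
   of the kernel, each within 4 e of zero. *)
have -> : sqn (span_sub [:: (1, z)] (samples b)) =
   \sum_i \sum_j b i * b j * (k z z - k z (a j) - k z (a i) + k (a i) (a j)).
  rewrite span_dotE ev_sub ev_cons ev_nil ev_samples/= addr0 mul1r.
  have F t : span_fun k (span_sub [:: (1, z)] (samples b)) t =
      k t z - \sum_j b j * k t (a j).
    by rewrite span_funE ev_sub ev_cons ev_nil ev_samples/= addr0 mul1r.
  rewrite !F; under eq_bigr => i _ do rewrite F.
  have E i : \sum_j b i * b j * (k z z - k z (a j) - k z (a i) + k (a i) (a j)) =
     b i * (k z z - \sum_j b j * k z (a j)) - b i * (k (a i) z - \sum_j b j * k (a i) (a j)).
    rewrite (kker.1 (a i) z) -mulrBr.
    rewrite -[k z z in RHS]mul1r -[k z (a i) in RHS]mul1r -S1 !mulr_suml.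
    rewrite -!sumrB mulr_sumr; apply: eq_bigr => j _ /=.
    by rewrite -/(b j); ring.
  under [RHS]eq_bigr => i _ do rewrite E.
  by rewrite [RHS]sumrB -mulr_suml S1 mul1r.
apply: (@le_trans _ _ (\sum_i \sum_j b i * b j * (4 * e))).
  apply: ler_sum => i _; apply: ler_sum => j _.
  rewrite {1 3}/b; case si : (i \in S); last by rewrite !mul0r.
  rewrite {1 2}/b; case sj : (j \in S); last by rewrite mul0r mulr0 !mul0r.
  apply: ler_wpM2l; first by rewrite mulr_ge0 ?divr_ge0 ?ler0n.
  have := ki i si; have := ki j sj; have := kij i j si sj; move: kz.
  rewrite !ler_norml; lra.
under eq_bigr => i _ do rewrite -mulr_suml -mulr_sumr S1 mulr1.
by rewrite -mulr_suml S1 mul1r.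
Qed.

End smoothing.

(** * Calculus on the unit interval *)

Section unit_interval_calculus.
Context {R : realType}.
Implicit Types (g h : unitI R -> R) (s t : unitI R).

Lemma unitI_bounds t : 0 <= val t <= 1.
Proof. by have := set_valP t; rewrite /= in_itv. Qed.

Lemma val_toI (x : R) : 0 <= x <= 1 -> val (toI x) = x.
Proof. by move=> /in_unitI x01; rewrite /toI val_insubd x01. Qed.

(** A continuous retraction of the line onto [0, 1], which transfers calculus on
the line to functions on [0, 1]; toI sends the outside to 0 and so is
discontinuous at 1. *)
Definition clampI (x : R) : unitI R := toI (Num.max 0 (Num.min 1 x)).

Lemma val_clampI x : val (clampI x) = Num.max 0 (Num.min 1 x).
Proof.
by rewrite val_toI// le_max lexx/= ge_max ler01 ge_min lexx.
Qed.

Lemma val_clampI_id x : 0 <= x <= 1 -> val (clampI x) = x.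
Proof. by move=> /andP[x0 x1]; rewrite val_clampI min_r// max_r. Qed.

Lemma clampI_toI x : 0 <= x <= 1 -> toI x = clampI x.
Proof. by move=> x01; apply: val_inj; rewrite /= val_toI// val_clampI_id. Qed.

Lemma clampIK t : clampI (val t) = t.
Proof. by apply: val_inj; rewrite /= val_clampI_id// unitI_bounds. Qed.

Lemma nbhs_unitIP t (A : set (unitI R)) :
  nbhs t A <-> exists2 e : R, 0 < e & forall s, `|val s - val t| < e -> A s.
Proof.
split.
  move=> /nbhs_ballP[e e0 eA]; exists e => // s st; apply: eA.
  by change (`|val t - val s| < e); rewrite distrC.
move=> [e e0 eA]; apply/nbhs_ballP; exists e => // s ts; apply: eA.
by rewrite distrC; exact: ts.
Qed.

Lemma clampI_lip x y : `|val (clampI x) - val (clampI y)| <= `|x - y|.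
Proof.
have := ler_norm (x - y); have := ler_norm (- (x - y)).
rewrite normrN !val_clampI ler_norml.
by case: (leP 1 x) => ?; case: (leP 1 y) => ?; rewrite ?(max_r (@ler01 R));
  case: (leP 0 x) => ?; case: (leP 0 y) => ?; lra.
Qed.

Lemma clampI_continuous : continuous clampI.
Proof.
move=> x A /= /nbhs_unitIP[e e0 eA]; apply/nbhs_ballP; exists e => // y.
rewrite /ball/= distrC => yx; apply: eA.
exact: le_lt_trans (clampI_lip _ _) yx.
Qed.

Lemma val_unitI_continuous : continuous (val : unitI R -> R).
Proof.
move=> t A /= /nbhs_ballP[e e0 eA]; apply/nbhs_unitIP; exists e => // s st.
by apply: eA; rewrite /ball/= distrC.
Qed.

Lemma unitI_point_at_distance t (d : R) : 0 < d <= 1 / 2 ->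
  exists2 s, s != t & `|val s - val t| = d.
Proof.
move=> /andP[d0 d2]; have /andP[t0 t1] := unitI_bounds t.
pose x := if val t <= 1 / 2 then val t + d else val t - d.
have x01 : 0 <= x <= 1 by rewrite /x; case: ifPn => ?; apply/andP; split; lra.
have xt : `|val (toI x) - val t| = d.
  rewrite val_toI// /x.
  by case: ifP => _; rewrite addrAC subrr add0r ?normrN gtr0_norm.
exists (toI x) => //; apply/eqP => xe.
by move: d0; rewrite -xt xe subrr normr0 ltxx.
Qed.

(** No point of [0, 1] is isolated, so derivatives are unique. *)
Lemma unitI_dnbhs_proper t : ProperFilter (t^').
Proof.
apply: Build_ProperFilter_ex => A /nbhs_unitIP[e e0 eA].
have [|s st sd] := @unitI_point_at_distance t (Num.min (e / 2) (1 / 2)).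
  by rewrite lt_min !divr_gt0//= ge_min lexx orbT.
exists s; apply: eA => //; rewrite sd gt_min; apply/orP; left; lra.
Qed.

Lemma is_derivIP g t l : is_derivI g t l <-> forall e, 0 < e ->
  exists2 d, 0 < d & forall s, s != t -> `|val s - val t| < d ->
    `|diff_quot g t s - l| < e.
Proof.
split=> [gl e e0|h].
  have : nbhs t (fun s => s != t -> ball l e (diff_quot g t s)).
    exact: (gl (ball l e) (nbhsx_ballx l e e0)).
  move=> /nbhs_unitIP[d d0 dA]; exists d => // s st sd.
  by have := dA s sd st; rewrite /ball/= distrC.
move=> A /nbhs_ballP[e e0 eA]; have [d d0 dA] := h e e0.
change (nbhs t (fun s => s != t -> A (diff_quot g t s))).
apply/nbhs_unitIP; exists d => // s sd st; apply: eA.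
by rewrite /ball/= distrC; exact: dA.
Qed.

Lemma derivIE g t l : is_derivI g t l -> derivI g t = l.
Proof.
by have PF := unitI_dnbhs_proper t; move=> gl; apply: cvg_lim => //.
Qed.

Lemma unitI_continuousP g : continuous g <-> forall t e, 0 < e ->
  exists2 d, 0 < d & forall s, `|val s - val t| < d -> `|g s - g t| < e.
Proof.
split=> [gc t e e0|h t A /nbhs_ballP[e e0 eA]].
  have /nbhs_unitIP[d d0 dA] : nbhs t (g @^-1` ball (g t) e).
    by apply: gc; exact: nbhsx_ballx.
  by exists d => // s /dA; rewrite /ball/= distrC.
have [d d0 dA] := h t e e0; apply/nbhs_unitIP; exists d => // s /dA st.
by apply: eA; rewrite /ball/= distrC.
Qed.

Lemma val_neq s t : s != t -> val s - val t != 0.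
Proof. by move=> st; rewrite subr_eq0; apply: contra st => /eqP/val_inj ->. Qed.

Lemma is_derivI_continuous g g1 :
  (forall t, is_derivI g t (g1 t)) -> continuous g.
Proof.
move=> gd; apply/unitI_continuousP => t e e0.
have [d d0 dA] := (is_derivIP g t (g1 t)).1 (gd t) 1 ltr01.
pose c := `|g1 t| + 1.
have c0 : 0 < c by rewrite ltr_wpDl.
exists (Num.min d (e / c)) => [|s].
  by rewrite lt_min d0 divr_gt0.
rewrite lt_min => /andP[sd se].
have [->|st] := eqVneq s t; first by rewrite subrr normr0.
have := dA s st sd; rewrite /diff_quot.
set q := _ / _ => qc.
have -> : g s - g t = q * (val s - val t) by rewrite /q divfK// val_neq.
have qlt : `|q| <= c.
  by rewrite -[q](subrK (g1 t)) addrC (le_trans (ler_normD _ _))// lerD2l ltW.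
rewrite normrM; apply: (@le_lt_trans _ _ (c * `|val s - val t|)).
  by rewrite ler_wpM2r.
by rewrite mulrC -ltr_pdivlMr.
Qed.

Lemma is_derivI_clamp g t l (x : R) : 0 < x < 1 -> val t = x ->
  is_derivI g t l -> is_derive x 1 (fun y => g (clampI y)) l.
Proof.
move=> /andP[x0 x1] tx /is_derivIP gl.
have H : (fun h : R => h^-1 *: (g (clampI (h *: 1 + x)) - g (clampI x))) @ 0^' --> l.
  apply/cvgrPdistC_lt => e e0; have [d d0 dA] := gl e e0.
  rewrite /dnbhs near_withinE; apply/nbhs_ballP.
  exists (Num.min d (Num.min x (1 - x))) => [|h].
    by rewrite /= !lt_min d0 x0 subr_gt0.
  rewrite /ball/= sub0r normrN !lt_min => /and3P[hd hx hx1] h0.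
  have hx01 : 0 <= h *: 1 + x <= 1.
    move: hx hx1; rewrite !ltr_norml [_ *: _]mulr1; lra.
  have vh : val (clampI (h *: 1 + x)) = h + x.
    by rewrite val_clampI_id// [_ *: _]mulr1.
  have tc : clampI x = t by rewrite -tx clampIK.
  have := dA (clampI (h *: 1 + x)).
  rewrite /diff_quot vh tx addrK tc mulrC; apply => //.
  by apply: contra h0 => /eqP/(congr1 val); rewrite /= vh tx -[RHS]add0r => /addIr ->.
split; first by apply/cvg_ex; exists l.
by apply: cvg_lim.
Qed.

Lemma clamp_comp_continuous g : continuous g -> continuous (g \o clampI).
Proof. by move=> gc x; apply: continuous_comp; [exact: clampI_continuous|exact: gc]. Qed.

Lemma unitI_MVT g g1 s t : (forall u, is_derivI g u (g1 u)) ->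
  exists u, Num.min (val s) (val t) <= val u <= Num.max (val s) (val t) /\
    g s - g t = g1 u * (val s - val t).
Proof.
move=> gd.
wlog st : s t / val t <= val s.
  move=> H; have /orP[st|st] := le_total (val t) (val s); first exact: H.
  have [u [ub uE]] := H t s st; exists u; split; first by rewrite minC maxC.
  by rewrite -opprB uE -mulrN opprB.
have /andP[s0 s1] := unitI_bounds s; have /andP[t0 t1] := unitI_bounds t.
have [||x xst] := @MVT_segment R (g \o clampI) (g1 \o clampI) _ _ st.
- move=> x; rewrite in_itv/= => /andP[tx xs].
  have x01 : 0 < x < 1 by rewrite (le_lt_trans t0 tx) (lt_le_trans xs s1).
  apply: (is_derivI_clamp x01 _ (gd (clampI x))).
  by rewrite val_clampI_id//; move: x01 => /andP[/ltW -> /ltW ->].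
- by apply: continuous_subspaceT; apply: clamp_comp_continuous;
    exact: is_derivI_continuous gd.
rewrite /= !clampIK => E; exists (clampI x); split => //.
move: xst; rewrite in_itv/= => /andP[tx xs].
rewrite val_clampI_id ?(le_trans t0 tx) ?(le_trans xs s1)//.
by rewrite min_r// max_l// tx.
Qed.

Local Notation mu := (@lebesgue_measure R).

Lemma clamp_integrable g : continuous g ->
  mu.-integrable `[0, 1] (fun x => (g (clampI x))%:E).
Proof.
move=> gc; apply: continuous_compact_integrable; first exact: segment_compact.
by apply: continuous_subspaceT; exact: clamp_comp_continuous.
Qed.

Lemma clamp_measurable g : continuous g ->
  measurable_fun [set: R] (fun x => g (clampI x)).
Proof.
move=> gc; apply: continuous_measurable_fun; exact: clamp_comp_continuous.
Qed.

Lemma norm_continuousI g : continuous g -> continuous (fun t => `|g t|).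
Proof.
move=> /unitI_continuousP gc; apply/unitI_continuousP => t e /(gc t)[d d0 dA].
exists d => // s /dA; apply: le_lt_trans; exact: ler_dist_dist.
Qed.

Lemma unitI_increment_le g g1 t :
  (forall u, is_derivI g u (g1 u)) -> continuous g1 ->
  `|g t - g zeroI| <= \int[mu]_(x in `[0, 1]) `|g1 (clampI x)|.
Proof.
move=> gd g1c.
have /andP[t0 t1] := unitI_bounds t.
have nc := norm_continuousI g1c.
have [t00|tN0] := eqVneq (val t) 0.
  have -> : t = zeroI by exact: val_inj.
  by rewrite subrr normr0; apply: Rintegral_ge0.
have tp : 0 < val t by rewrite lt_def tN0.
have sub : `[0, val t]%classic `<=` `[0, 1]%classic.
  by move=> x /=; rewrite !in_itv/= => /andP[-> /le_trans]; apply.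
have gcc : continuous (g \o clampI).
  exact: clamp_comp_continuous (is_derivI_continuous gd).
have FTC : (\int[mu]_(x in `[0%R, val t]) (g1 (clampI x))%:E =
    (g t)%:E - (g zeroI)%:E)%E.
  rewrite (@continuous_FTC2 R (g1 \o clampI) (g \o clampI))//=.
  - rewrite clampIK; congr (_ - (g _)%:E)%E; apply: val_inj => /=.
    by rewrite val_clampI_id ?lexx ?ler01.
  - by apply: continuous_subspaceT; exact: clamp_comp_continuous.
  - split.
    + move=> x; rewrite in_itv/= => /andP[x0 xt].
      have x01 : 0 < x < 1 by rewrite x0 (lt_le_trans xt t1).
      suff : is_derive x 1 (g \o clampI) (g1 (clampI x)) by case.
      apply: (is_derivI_clamp x01 _ (gd (clampI x))).
      by rewrite val_clampI_id//; move: x01 => /andP[/ltW -> /ltW ->].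
    + by apply: cvg_at_right_filter; exact: gcc.
    + by apply: cvg_at_left_filter; exact: gcc.
  - move=> x; rewrite in_itv/= => /andP[x0 xt].
    have x01 : 0 < x < 1 by rewrite x0 (lt_le_trans xt t1).
    rewrite derive1E; apply: derive_val.
    apply: (is_derivI_clamp x01 _ (gd (clampI x))).
    by rewrite val_clampI_id//; move: x01 => /andP[/ltW -> /ltW ->].
have -> : g t - g zeroI = \int[mu]_(x in `[0, val t]) g1 (clampI x).
  by rewrite /Rintegral FTC.
have i1 := clamp_integrable g1c.
have i2 : mu.-integrable `[0, val t] (fun x => (g1 (clampI x))%:E).
  by apply: integrableS i1.
apply: (le_trans (le_normr_Rintegral _ i2)) => //.
have i3 := clamp_integrable nc.
apply: fine_le; [exact: integrable_fin_num (integrable_norm i2)|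
  exact: integrable_fin_num i3|].
apply: ge0_subset_integral => //.
by apply/measurable_EFinP; apply: measurable_funTS; exact: (clamp_measurable nc).
Qed.

End unit_interval_calculus.

Lemma is_derivI_sub {R : realType} (g h : unitI R -> R) t l m :
  is_derivI g t l -> is_derivI h t m -> is_derivI (fun u => g u - h u) t (l - m).
Proof.
move=> gl hm.
have E : diff_quot (fun u => g u - h u) t =
    (fun s => diff_quot g t s - diff_quot h t s).
  apply/funext => s; rewrite /diff_quot -mulrBl; congr (_ / _); ring.
rewrite /is_derivI E.
have FF : Filter (t^') := (unitI_dnbhs_proper t).
exact: cvgB.
Qed.

Section linear_combinations.
Context {R : realType} (n : nat) (y : 'I_n -> R).

Lemma lincomb_continuousI (c : 'I_n -> unitI R -> R) :
  (forall i, continuous (c i)) -> continuous (fun t => \sum_i y i * c i t).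
Proof.
move=> cc; apply: continuous_big => [|i _]; first exact: add_continuous.
move=> t; apply: (@continuous_comp _ _ _ (c i) ( *%R (y i))); first exact: cc.
exact: mulrl_continuous.
Qed.

Lemma is_derivI_lincomb (c c' : 'I_n -> unitI R -> R) t :
  (forall i, is_derivI (c i) t (c' i t)) ->
  is_derivI (fun u => \sum_i y i * c i u) t (\sum_i y i * c' i t).
Proof.
move=> dc.
have E : diff_quot (fun u => \sum_i y i * c i u) t =
    (fun s => \sum_i y i * diff_quot (c i) t s).
  apply/funext => s; rewrite /diff_quot -sumrB mulr_suml.
  by apply: eq_bigr => i _; rewrite -mulrBr mulrA.
rewrite /is_derivI E.
have FF : Filter (t^') := (unitI_dnbhs_proper t).
apply: cvg_big => [|i _]; first exact: add_continuous.
by apply: cvgM; [exact: cvg_cst|exact: dc].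
Qed.

End linear_combinations.

(** Bounds a first moment by a second moment with a free parameter. *)
Lemma norm_le_add_sqr {R : realFieldType} (x del : R) : 0 < del ->
  `|x| <= del + del^-1 * x ^+ 2.
Proof.
move=> d0; rewrite -(real_normK (num_real x)) -subr_ge0.
have -> : del + del^-1 * `|x| ^+ 2 - `|x| =
   del^-1 * ((`|x| - del / 2) ^+ 2 + 3 / 4 * del ^+ 2).
  by field; rewrite gt_eqF.
by rewrite mulr_ge0 ?invr_ge0 ?(ltW d0)// addr_ge0 ?sqr_ge0// mulr_ge0 ?sqr_ge0.
Qed.

Section compactness.
Context {R : realType}.

(** Compactness of [0, 1] in near-covering form, transferred by the retraction. *)
Lemma unitI_near_uniform (I : Type) (F : set_system I) (P : I -> unitI R -> Prop) :
  Filter F ->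
  (forall t : unitI R, exists2 d : R, 0 < d &
     \forall i \near F, forall s, `|val s - val t| < d -> P i s) ->
  \forall i \near F, forall t, P i t.
Proof.
move=> FF h.
have /compact_near_coveringP cov := @segment_compact R 0 1.
have := cov I F (fun i x => P i (clampI x)) FF.
have H (x : R) : `[0, 1]%classic x ->
    \forall x' \near x & i \near F, P i (clampI x').
  rewrite /= in_itv/= => x01.
  have [d d0 dP] := h (clampI x).
  exists (ball x d, [set i | forall s, `|val s - val (clampI x)| < d -> P i s]).
    by split => //=; exact: nbhsx_ballx.
  move=> [x' i] /= [xx' iP]; apply: iP; apply: le_lt_trans (clampI_lip _ _) _.
  by rewrite distrC.
move=> /(_ H); apply: filterS => i iP t.
by rewrite -[t]clampIK; apply: iP; rewrite /= in_itv/=; exact: unitI_bounds.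
Qed.

Lemma unitI_uniform_small (P : R -> unitI R -> Prop) :
  (forall d d' t, d' <= d -> P d t -> P d' t) ->
  (forall t : unitI R, exists2 d : R, 0 < d &
     forall s, `|val s - val t| < d -> P d s) ->
  exists2 d : R, 0 < d & forall t, P d t.
Proof.
move=> mono h.
have H : \forall d \near (0 : R)^'+, forall t, P d t.
  apply: unitI_near_uniform => t; have [d d0 dP] := h t; exists d => //.
  near=> e => s /dP; apply: mono.
  by near: e; apply: nbhs_right_le.
near (0 : R)^'+ => d; exists d; near: d; first exact: nbhs_right_gt.
exact: H.
Unshelve. all: by end_near. Qed.

(** Applied to the mixed derivative of the kernel, whose values near a diagonal
point are the inner products of short difference quotients. *)
Lemma diagonal_uniform (G : unitI R * unitI R -> R) (e : R) :
  continuous G -> 0 < e -> exists2 d : R, 0 < d & forall t x y : unitI R,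
    `|val x - val t| < d -> `|val y - val t| < d ->
    `|G (x, y) - G (t, t)| < e.
Proof.
move=> Gc e0.
apply: (@unitI_uniform_small (fun d t => forall x y : unitI R,
  `|val x - val t| < d -> `|val y - val t| < d -> `|G (x, y) - G (t, t)| < e)).
  move=> d d' t dd h x y xt yt; apply: h; exact: lt_le_trans dd.
move=> t.
have := Gc (t, t) _ (nbhsx_ballx _ (e / 2) _).
move=> /(_ (divr_gt0 e0 (ltr0n _ 2)))[[A B]/= [/nbhs_unitIP[d1 d10 Ad] /nbhs_unitIP[d2 d20 Bd]] AB].
pose m := Num.min d1 d2.
have m0 : 0 < m by rewrite lt_min d10.
have H x y : `|val x - val t| < m -> `|val y - val t| < m ->
    `|G (x, y) - G (t, t)| < e / 2.
  rewrite !lt_min => /andP[x1 x2] /andP[y1 y2].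
  by have := AB (x, y) (conj (Ad x x1) (Bd y y2)); rewrite /ball/= distrC.
exists (m / 2); first by rewrite divr_gt0.
move=> s st x y xs ys.
have tri (z : unitI R) : `|val z - val s| < m / 2 -> `|val z - val t| < m.
  move=> zs; rewrite -[val z](subrK (val s)) -addrA.
  by rewrite (le_lt_trans (ler_normD _ _))// [ltRHS]splitr ltrD.
have sm : `|val s - val t| < m by apply: lt_trans st _; rewrite ltr_pdivrMr// ltr_pMr// ltr1n.
have h1 := H x y (tri x xs) (tri y ys); have h2 := H s s sm sm.
have -> : G (x, y) - G (s, s) =
    (G (x, y) - G (t, t)) - (G (s, s) - G (t, t)) by ring.
rewrite (le_lt_trans (ler_normB _ _))// [ltRHS]splitr.
by rewrite ltrD.
Qed.

End compactness.

Section integrals.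
Context {R : realType}.
Local Notation mu := (@lebesgue_measure R).

Import HBNNSimple.

(** The integral of a nonnegative function is a supremum over the simple
functions below it, so it is monotone without any measurability; this is applied
to suprema over the complex and to differences of variations. *)
Lemma ge0_integral_mono d (T : measurableType d) (P : {measure set T -> \bar R})
    (f g : T -> \bar R) : (forall x, 0 <= f x)%E ->
  (forall x, f x <= g x)%E -> (\int[P]_x f x <= \int[P]_x g x)%E.
Proof.
move=> f0 fg; have g0 x : (0 <= g x)%E by exact: le_trans (fg x).
rewrite !ge0_integralTE//; apply: ereal_sup_le => _ [h hf <-].
by exists h => // x; exact: le_trans (hf x) (fg x).
Qed.

Lemma lebesgue_unitI : mu `[0, 1] = 1%E.
Proof.
by rewrite lebesgue_measure_itv/= lte_fin ltr01 oppr0 adde0.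
Qed.

Lemma sqr_continuousI (g : unitI R -> R) :
  continuous g -> continuous (fun t => g t ^+ 2).
Proof.
move=> gc t; apply: (@continuous_comp _ _ _ g (fun x : R => x ^+ 2)).
  exact: gc.
exact: sqr_continuous.
Qed.

Lemma sub_continuousI (g h : unitI R -> R) :
  continuous g -> continuous h -> continuous (fun t => g t - h t).
Proof.
move=> /unitI_continuousP gc /unitI_continuousP hc; apply/unitI_continuousP.
move=> t e e0; have e2 : 0 < e / 2 by rewrite divr_gt0.
have [d d0 dP] := gc t _ e2; have [d' d'0 dP'] := hc t _ e2.
exists (Num.min d d') => [|s]; first by rewrite lt_min d0.
rewrite lt_min => /andP[/dP gs /dP' hs].
have -> : g s - h s - (g t - h t) = (g s - g t) - (h s - h t) by ring.
by rewrite (le_lt_trans (ler_normB _ _))// [ltRHS]splitr ltrD.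
Qed.

Lemma unitI_integral_sqr (g : unitI R -> R) : continuous g ->
  (\int[mu]_(x in `[0%R, 1%R]) (g (clampI x) ^+ 2)%:E)%E =
  (\int[mu]_(x in `[0, 1]) (g (clampI x) ^+ 2))%:E.
Proof.
move=> gc; rewrite /Rintegral fineK//; apply: integrable_fin_num => //.
exact: (clamp_integrable (sqr_continuousI gc)).
Qed.

Lemma clamp_Rint_le_pointwise (g : unitI R -> R) (al be ga : R) : continuous g ->
  (forall t, al * `|g t| <= be + ga * g t ^+ 2) ->
  al * (\int[mu]_(x in `[0, 1]) `|g (clampI x)|) <=
  be + ga * \int[mu]_(x in `[0, 1]) (g (clampI x) ^+ 2).
Proof.
move=> gc H.
have sc := sqr_continuousI gc.
have i1 := clamp_integrable (norm_continuousI gc).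
have i2 := clamp_integrable sc.
have i0 : mu.-integrable `[0, 1] (EFin \o cst be).
  by apply: (@clamp_integrable _ (cst be)); exact: cst_continuous.
have i3 : mu.-integrable `[0, 1] (EFin \o (fun x => ga * g (clampI x) ^+ 2)).
  exact: (integrableZl _ ga i2).
have i4 : mu.-integrable `[0, 1] (EFin \o (fun x => al * `|g (clampI x)|)).
  exact: (integrableZl _ al i1).
rewrite -!RintegralZl//.
have -> : be = \int[mu]_(x in `[0, 1]) be.
  by rewrite Rintegral_cst// [X in fine X]lebesgue_unitI mulr1.
rewrite -RintegralD//.
apply: le_Rintegral => //.
exact: (integrableD _ i0 i3).
Qed.

Lemma clamp_Rint_norm_le (g : unitI R -> R) (del : R) : continuous g -> 0 < del ->
  \int[mu]_(x in `[0, 1]) `|g (clampI x)| <=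
  del + del^-1 * \int[mu]_(x in `[0, 1]) (g (clampI x) ^+ 2).
Proof.
move=> gc d0; rewrite -[leLHS]mul1r; apply: clamp_Rint_le_pointwise => // t.
by rewrite mul1r norm_le_add_sqr.
Qed.

(** Jensen's inequality on [0, 1], integrating 2 A |g| <= A^2 + g^2 with A the
mean of |g|. *)
Lemma clamp_Rint_norm_sqr_le (g : unitI R -> R) : continuous g ->
  (\int[mu]_(x in `[0, 1]) `|g (clampI x)|) ^+ 2 <=
  \int[mu]_(x in `[0, 1]) (g (clampI x) ^+ 2).
Proof.
move=> gc; set A := \int[mu]_(x in `[0, 1]) `|g (clampI x)|.
have := @clamp_Rint_le_pointwise g (2 * A) (A ^+ 2) 1 gc.
rewrite -/A => H; have {}H := H _; rewrite -subr_ge0.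
have {}H : 2 * A * A <= A ^+ 2 + 1 * \int[mu]_(x in `[0, 1]) (g (clampI x) ^+ 2).
  apply: H => t; rewrite mul1r -(real_normK (num_real (g t))).
  by have := sqr_ge0 (A - `|g t|); lra.
by move: H; lra.
Qed.

Lemma variationIE (g g' : unitI R -> R) : continuous g' ->
  (forall t, is_derivI g t (g' t)) ->
  variationI g = (\int[mu]_(x in `[0, 1]) `|g' (clampI x)|)%:E.
Proof.
move=> gc gd; rewrite /variationI /Rintegral fineK; last first.
  apply: integrable_fin_num => //.
  exact: (clamp_integrable (norm_continuousI gc)).
apply: eq_integral => x; rewrite inE/= in_itv/= => x01.
by rewrite (clampI_toI x01) (derivIE (gd _)).
Qed.

Lemma variationI_dist_sqr_le (g h g' h' : unitI R -> R) :
  continuous g' -> continuous h' ->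
  (forall t, is_derivI g t (g' t)) -> (forall t, is_derivI h t (h' t)) ->
  (`|variationI g - variationI h| ^+ 2 <=
   \int[mu]_(x in `[0%R, 1%R]) ((g' (clampI x) - h' (clampI x)) ^+ 2)%:E)%E.
Proof.
move=> gc hc gd hd.
have dc := sub_continuousI gc hc.
rewrite (variationIE gc gd) (variationIE hc hd).
rewrite (unitI_integral_sqr dc) -EFinB abse_EFin -EFin_expe lee_fin.
apply: le_trans (clamp_Rint_norm_sqr_le dc).
rewrite lerXn2r ?nnegrE//; first by apply: Rintegral_ge0.
have ig := clamp_integrable (norm_continuousI gc).
have ih := clamp_integrable (norm_continuousI hc).
rewrite -RintegralB//.
have idd : mu.-integrable `[0, 1] (EFin \o (fun x => `|g' (clampI x)| - `|h' (clampI x)|)).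
  exact: (integrableB _ ig ih).
apply: (le_trans (le_normr_Rintegral _ idd)) => //.
apply: le_Rintegral => //.
- exact: integrable_norm idd.
- exact: (clamp_integrable (norm_continuousI dc)).
- by move=> x _; exact: ler_dist_dist.
Qed.

End integrals.

(** * Kernel-space functions along a curve *)

Section difference_functionals.
Context {R : realType} {Z : Type} (k : Z -> Z -> R) (kker : is_kernel k).
Variables (c : unitI R -> Z).
Implicit Types (s t : unitI R).
Local Notation sqn u := (span_dot k u u).

(** Difference quotients as elements of the span, where their norm and their cost
make sense. *)
Definition slope t s : seq (R * Z) :=
  [:: ((val s - val t)^-1, c s); (- (val s - val t)^-1, c t)].

Lemma ev_slope g t s : ev g (slope t s) = diff_quot (g \o c) t s.
Proof. by rewrite /slope !ev_cons ev_nil /diff_quot /=; ring. Qed.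

Hypothesis kc : C_II 2 (fun p => k (c p.1) (c p.2)).

(** By the mean value theorem in each variable, the inner product of two
difference quotients is a value of the mixed derivative, so all quotients
taken in a small interval are close to each other in norm. *)
Lemma slope_uniform_cauchy (e : R) : 0 < e ->
  exists2 d : R, 0 < d & forall u t s t' s' : unitI R,
    s != t -> s' != t' ->
    `|val t - val u| < d -> `|val s - val u| < d ->
    `|val t' - val u| < d -> `|val s' - val u| < d ->
    sqn (span_sub (slope t s) (slope t' s')) <= e.
Proof.
case: kc => kcc [g1 [g2 [dg1 _ [g1c [g11 [g12 [_ dg12 _ g12c]]]] _]]] e0.
have [d d0 dP] := diagonal_uniform g12c (divr_gt0 e0 (ltr0n R 4)).
exists d => // u t s t' s' st st' tu su tu' su'.
have near (x y z : unitI R) : `|val x - val u| < d -> `|val y - val u| < d ->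
    Num.min (val x) (val y) <= val z <= Num.max (val x) (val y) ->
    `|val z - val u| < d.
  move=> xu yu /andP[mz zM]; have [xy|yx] := lerP (val x) (val y).
    move: xu yu mz zM; rewrite min_l// max_r// !ltr_norml; clear; lra.
  move: xu yu mz zM; rewrite min_r ?max_l ?(ltW yx)// !ltr_norml; clear; lra.
have D (x y x' y' : unitI R) : x != y -> x' != y' -> `|val x - val u| < d ->
    `|val y - val u| < d -> `|val x' - val u| < d -> `|val y' - val u| < d ->
    `|span_dot k (slope x y) (slope x' y') - g12 (u, u)| < e / 4.
  move=> xy xy' xu yu xu' yu'.
  have dh v : is_derivI (fun w => k (c w) (c y') - k (c w) (c x')) v
      (g1 (v, y') - g1 (v, x')).
    by apply: is_derivI_sub; exact: dg1.
  (* First in the left variable, then in the right one at the point p found. *)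
  have [p [pb pE]] := unitI_MVT y x dh.
  have [q [qb qE]] := unitI_MVT y' x' (dg12 p).
  have yx : val y - val x != 0 by apply: val_neq; rewrite eq_sym.
  have yx' : val y' - val x' != 0 by apply: val_neq; rewrite eq_sym.
  have -> : span_dot k (slope x y) (slope x' y') = g12 (p, q).
    rewrite /span_dot /slope !big_cons !big_nil /=.
    rewrite qE in pE.
    have -> : g12 (p, q) = (g12 (p, q) * (val y' - val x') * (val y - val x)) /
        ((val y' - val x') * (val y - val x)).
      by field; apply/andP.
    by rewrite -pE /=; field; apply/andP.
  by apply: dP; [apply: near pb|apply: near qb].
have E g : ev g (span_sub (slope t s) (slope t' s')) =
   1 * ev g (slope t s) + (-1) * ev g (slope t' s').
  by rewrite ev_sub mul1r mulN1r.
rewrite (sqn_lin kker E).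
have ts : t != s by rewrite eq_sym.
have ts' : t' != s' by rewrite eq_sym.
have := D _ _ _ _ ts ts tu su tu su.
have := D _ _ _ _ ts ts' tu su tu' su'.
have := D _ _ _ _ ts' ts' tu' su' tu' su'.
rewrite !ltr_norml; clear; lra.
Qed.

(** A kernel-space function maps the Cauchy family of difference quotients to a
Cauchy family of reals, uniformly in the base point; so its derivative along c
exists and is continuous. *)
Lemma rkhs_bounded_C1 M g : rkhs_bounded k M g ->
  exists2 g' : unitI R -> R, continuous g' & forall t, is_derivI (g \o c) t (g' t).
Proof.
move=> [M0 gM].
have B (e : R) : 0 < e -> exists2 d : R, 0 < d & forall u t s t' s' : unitI R,
    s != t -> s' != t' ->
    `|val t - val u| < d -> `|val s - val u| < d ->
    `|val t' - val u| < d -> `|val s' - val u| < d ->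
    `|diff_quot (g \o c) t s - diff_quot (g \o c) t' s'| < e.
  move=> e0; pose e' := e ^+ 2 / (M + 1).
  have M1 : 0 < M + 1 by rewrite ltr_wpDl.
  have e'0 : 0 < e' by rewrite divr_gt0 ?exprn_gt0.
  have [d d0 dP] := slope_uniform_cauchy e'0.
  exists d => // u t s t' s' st st' tu su tu' su'.
  rewrite -!ev_slope -ev_sub -(ltr_pXn2r (n := 2)) ?nnegrE ?(ltW e0)//.
  rewrite real_normK ?num_real//; apply: le_lt_trans (gM _) _.
  have := ler_wpM2l M0 (dP _ _ _ _ _ st st' tu su tu' su').
  have : M * e' < e ^+ 2.
    by rewrite /e' mulrA ltr_pdivrMr// mulrC ltr_pM2l ?exprn_gt0// ltrDl.
  by move=> h1 h2; exact: le_lt_trans h1.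
have dcv t : cvg (diff_quot (g \o c) t @ t^').
  have PF := unitI_dnbhs_proper t.
  apply/cauchy_cvgP/cauchy_exP => e e0; have [d d0 dP] := B e e0.
  have [|s st sd] := @unitI_point_at_distance R t (Num.min (d / 2) (1 / 2)).
    by rewrite lt_min !divr_gt0//= ge_min lexx orbT.
  have sd' : `|val s - val t| < d.
    by rewrite sd gt_min; apply/orP; left; lra.
  have tt : `|val t - val t| < d by rewrite subrr normr0.
  exists (diff_quot (g \o c) t s).
  apply/nbhs_unitIP; exists d => // s' st'd st'.
  exact: (dP t).
exists (fun t => lim (diff_quot (g \o c) t @ t^')); last by move=> t; exact: dcv.
apply/unitI_continuousP => t e e0.
have e3 : 0 < e / 3 by rewrite divr_gt0.
have [d d0 dP] := B _ e3.
have pick (u : unitI R) : exists s, [/\ s != u, `|val s - val u| < d / 2 &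
    `|diff_quot (g \o c) u s - lim (diff_quot (g \o c) u @ u^')| < e / 3].
  have [d' d'0 dP'] := (is_derivIP _ _ _).1 (dcv u) _ e3.
  have [|s st sd] := @unitI_point_at_distance R u
      (Num.min (Num.min (d / 4) (d' / 2)) (1 / 2)).
    by rewrite !lt_min !divr_gt0//= ge_min lexx orbT.
  exists s; split => //; last apply: dP' => //.
  - by rewrite sd !gt_min; apply/orP; left; apply/orP; left; lra.
  - by rewrite sd !gt_min; apply/orP; left; apply/orP; right; lra.
exists (d / 2); first by rewrite divr_gt0.
move=> s st; have [s1 [ss1 s1d s1e]] := pick s; have [t1 [tt1 t1d t1e]] := pick t.
have d2 : d / 2 < d by rewrite ltr_pdivrMr// ltr_pMr// ltr1n.
have s1t : `|val s1 - val t| < d.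
  rewrite -[val s1](subrK (val s)) -addrA.
  by rewrite (le_lt_trans (ler_normD _ _))// [ltRHS]splitr ltrD.
have tt : `|val t - val t| < d by rewrite subrr normr0.
have := dP t s s1 t t1 ss1 tt1 (lt_trans st d2) s1t tt (lt_trans t1d d2).
move: s1e t1e.
rewrite !ltr_norml; clear; lra.
Qed.

End difference_functionals.

(** * Topology of the complex *)

(** If a dense sequence visits a nonempty open set U only finitely often, then U
is finite, hence also closed, hence the whole space by connectedness. A finite
connected T1 space is a point, which every term of the sequence visits. *)
Lemma dense_seq_infinitely_often (X : topologicalType) (a : nat -> X) (U : set X) :
  accessible_space X -> connected [set: X] -> dense (range a) ->
  open U -> U !=set0 -> infinite_set [set i | U (a i)].
Proof.
move=> T1 Xc ad oU U0 finI.
pose F := a @` [set i | U (a i)].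
have finF : finite_set F by exact: finite_image.
have FU : F `<=` U by move=> _ [i Ui <-].
have closedfin (A : set X) : finite_set A -> closed A.
  by move: A; apply/accessible_finite_set_closed.
have UF : U = F.
  apply/seteqP; split=> // x Ux; apply: contrapT => Fx.
  have [|y [[Uy Fy] [i _ ai]]] := ad (U `&` ~` F) (ex_intro _ x (conj Ux Fx)).
    by apply: openI => //; apply: closed_openC; exact: closedfin.
  by apply: Fy; exists i => //=; rewrite ai.
have UT : U = setT.
  apply: Xc => //; first by exists U; rewrite ?setTI.
  by exists U; rewrite ?setTI// UF; exact: closedfin.
have finT : finite_set [set: X] by rewrite -UT UF.
have U1 : [set a 0%N] = setT.
  apply: Xc; first by exists (a 0%N).
  - exists [set a 0%N]; rewrite ?setTI// -[X in open X]setCK.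
    by apply: closed_openC; apply: closedfin; apply: sub_finite_set finT.
  - by exists [set a 0%N]; rewrite ?setTI//; apply: closedfin.
apply: infinite_nat; apply: sub_finite_set finI => i _ /=.
by rewrite UT.
Qed.

Section cw_topology.
Context {R : realType} {Z0 L : finType} (phi : L -> bool -> Z0).

Lemma cell_continuous l : continuous (cell phi l : unitI R -> cw R phi).
Proof.
have h1 : continuous (fun t : unitI R => @pre_cell R Z0 L l t : @cw_pre R Z0 L).
  exact: (@existT_continuous _ (@cw_piece R Z0 L) (Some l)).
have h2 : continuous (\pi_(cw R phi) : @cw_pre R Z0 L -> cw R phi)%qT.
  exact: (@pi_continuous _ (cw R phi)).
by move=> t A nA; exact: (h1 t _ (h2 _ _ nA)).
Qed.

Lemma cw_cases (z : cw R phi) :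
  (exists v, z = vertex phi v) \/ (exists l t, z = cell phi l t).
Proof.
rewrite -[z]reprK; case: (repr z) => -[l|] x.
- by right; exists l, x.
- by left; exists x.
Qed.

(** Each cell meets a gluing class in finitely many points. *)
Lemma cw_accessible : accessible_space (cw R phi).
Proof.
suff cl (z : cw R phi) : closed [set z].
  by move=> x y xy; exists (~` [set y]); rewrite !inE; split;
    [exact: closed_openC|apply/eqP|by move=> /=; rewrite /setC/= => /(_ erefl)].
rewrite -[X in closed X]setCK; apply: open_closedC.
change (open (\pi_(cw R phi)%qT @^-1` (~` [set z]))).
apply/sigT_openP => -[l|]; last exact: discrete_open.
set A := _ @^-1` _.
suff : closed (~` A) by move=> /closed_openC; rewrite setCK.
pose y0 := cw_attach phi (repr z).
have AE t : (~` A) t -> cw_attach phi (@pre_cell R Z0 L l t) = y0.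
  rewrite /A /= => /contrapT zt.
  have : (\pi_(cw R phi) (@pre_cell R Z0 L l t) = \pi_(cw R phi) (repr z))%qT.
    by rewrite reprK.
  by move/eqmodP/eqP.
have AC t : cw_attach phi (@pre_cell R Z0 L l t) = y0 -> (~` A) t.
  move=> ty; apply => /=.
  have : (\pi_(cw R phi) (@pre_cell R Z0 L l t) = \pi_(cw R phi) (repr z))%qT.
    by apply/eqmodP/eqP.
  by rewrite reprK.
pose B : set R := [set 0; 1] `|` (val @` [set t : unitI R | @pre_cell R Z0 L l t = y0]).
have -> : ~` A = val @^-1` (val @` (~` A)).
  apply/seteqP; split => [t At|t /= [s As /val_inj <-]]//; by exists t.
apply: (@closed_comp _ _ (val : unitI R -> R)).
  by move=> t _; exact: val_unitI_continuous.
have : finite_set (val @` (~` A)).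
  apply: (@sub_finite_set _ _ B).
    move=> _ [t /AE + <-]; rewrite /=.
    case: ifPn => [/eqP -> _|_]; first by left; left.
    case: ifPn => [/eqP -> _|_ ty]; first by left; right.
    by right; exists t.
  rewrite finite_setU; split; first exact: finite_set2.
  apply: finite_image; have [t0|n0] := pselect (exists t : unitI R, @pre_cell R Z0 L l t = y0).
    case: t0 => t0 t0y; apply: (@sub_finite_set _ _ [set t0]); last exact: finite_set1.
    by move=> t /=; rewrite -t0y => /eqP; rewrite eq_Tagged/= => /eqP.
  apply: (@sub_finite_set _ _ set0); last exact: finite_set0.
  by move=> t ty; case: n0; exists t.
have RT1 : accessible_space R by apply: hausdorff_accessible; exact: Rhausdorff.
exact: (accessible_finite_set_closed.1 RT1).
Qed.

End cw_topology.

(** * The cost tends to zero *)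

Lemma C_II_pred {R : realType} r (g : unitI R * unitI R -> R) :
  C_II r.+1 g -> C_II r g.
Proof.
elim: r g => [|r IH] g [gc H] //; split => //.
have [g1 [g2 [d1 d2 c1 c2]]] := H.
by exists g1, g2; split => //; apply: IH.
Qed.

Lemma infinite_set_count (A : set nat) (m : nat) : infinite_set A ->
  exists N, forall n, (N <= n)%N -> (m <= \sum_(i < n) `[< A i >])%N.
Proof.
move=> Ainf; elim: m => [|m [N HN]]; first by exists 0%N.
have [i [Ni Ai]] : exists i, (N <= i)%N /\ A i.
  apply: contrapT => noi; apply: Ainf; apply: (@sub_finite_set _ _ `I_N).
    move=> i Ai /=; rewrite ltnNge; apply/negP => Ni.
    by apply: noi; exists i.
  exact: finite_II.
exists i.+1 => n lin.
rewrite -(big_mkord predT (fun i => `[< A i >] : nat)) (big_cat_nat (n := i.+1))//=.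
apply: leq_trans (leq_addr _ _).
by rewrite big_nat_recr//= (asboolT Ai) addn1 ltnS big_mkord HN.
Qed.

Section cost_vanishes.
Context {R : realType}.
Variables (X : topologicalType) (k : X -> X -> R) (kker : is_kernel k).
Hypothesis kcont : continuous (fun p : X * X => k p.1 p.2).
Variables (sigma : R) (sigma_gt0 : 0 < sigma) (a : nat -> X).
Hypothesis visits : forall U : set X, open U -> U !=set0 ->
  infinite_set [set i | U (a i)].

Lemma point_cost_small (z0 : X) (e : R) : 0 < e ->
  exists2 U : set X, nbhs z0 U & exists N, forall n, (N <= n)%N ->
    forall z, U z -> exists b : 'I_n -> R, cost k sigma a [:: (1, z)] b <= e.
Proof.
move=> e0.
have e8 : 0 < e / 8 by rewrite divr_gt0.
have [[A B]/= [Az Bz] AB] : nbhs (z0, z0)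
    ((fun p : X * X => k p.1 p.2) @^-1` ball (k z0 z0) (e / 8)).
  by apply: kcont; exact: nbhsx_ballx.
have [U [oU Uz] UAB] : exists2 U, open_nbhs z0 U & U `<=` A `&` B.
  have : nbhs z0 (A `&` B) by exact: filterI.
  by rewrite nbhsE => -[U]; exists U.
have kU x y : U x -> U y -> `|k x y - k z0 z0| <= e / 8.
  move=> /UAB[Ax _] /UAB[_ By].
  by have := AB (x, y) (conj Ax By); rewrite /ball/= distrC => /ltW.
exists U; first exact: open_nbhs_nbhs.
(* With m samples the penalty is at most e / 2. *)
pose m := (Num.truncn (2 * sigma ^+ 2 / e)).+1.
have mlarge : sigma ^+ 2 / m%:R <= e / 2.
  have : 2 * sigma ^+ 2 / e < m%:R by rewrite /m truncnS_gt.
  rewrite ltr_pdivrMr// => h.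
  rewrite ler_pdivrMr ?ltr0n//; lra.
have [N HN] := infinite_set_count m (visits oU (ex_intro _ z0 Uz)).
exists N => n Nn z Uz'.
pose S := [set i : 'I_n | `[< U (a i) >]]%SET.
have mS : (m <= #|S|)%N.
  rewrite -sum1_card big_mkcond/=; apply: leq_trans (HN n Nn) _.
  by apply: leq_sum => i _; rewrite inE; case: `[< _ >].
have S0 : (0 < #|S|)%N by apply: leq_trans mS.
exists (fun i => (i \in S)%:R / #|S|%:R).
apply: (le_trans (@cost_average _ _ k kker sigma a n #|S| S (e / 8) (k z0 z0) z
  S0 erefl _ _ _)).
- exact: kU.
- by move=> i; rewrite inE => /asboolP Ui; exact: kU.
- by move=> i j; rewrite !inE => Ui Uj; exact: kU.
have : sigma ^+ 2 / #|S|%:R <= sigma ^+ 2 / m%:R.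
  by apply: ler_wpM2l; rewrite ?sqr_ge0// lef_pV2 ?posrE ?ltr0n ?ler_nat.
by move: mlarge; lra.
Qed.

Section curve.
Variables (c : unitI R -> X) (cc : continuous c).
Hypothesis kc : C_II 2 (fun p => k (c p.1) (c p.2)).

Lemma curve_cost_small (e : R) : 0 < e ->
  exists N, forall n, (N <= n)%N -> forall t : unitI R,
    exists b : 'I_n -> R, cost k sigma a [:: (1, c t)] b <= e.
Proof.
move=> e0.
have [N _ HN] : \forall n \near \oo, forall t : unitI R,
    exists b : 'I_n -> R, cost k sigma a [:: (1, c t)] b <= e.
  apply: unitI_near_uniform => t.
  have [U Uct [N HN]] := point_cost_small (c t) e0.
  have /nbhs_unitIP[d d0 dU] : nbhs t (c @^-1` U) by exact: cc.
  by exists d => //; exists N => // n Nn s st; apply: HN => //; exact: dU.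
by exists N.
Qed.

(** A short difference quotient is replaced by one of fixed width h, and then the
two end points of the latter are predicted. The factor h^-2 lost there is
compensated by the choice of N, as h depends only on e. *)
Lemma slope_cost_small (e : R) : 0 < e ->
  exists N, forall n, (N <= n)%N -> forall t : unitI R,
    exists2 d : R, 0 < d & forall s : unitI R, s != t ->
      `|val s - val t| < d ->
      exists b : 'I_n -> R, cost k sigma a (slope c t s) b <= e.
Proof.
move=> e0.
have [d d0 dP] := slope_uniform_cauchy kker kc (divr_gt0 e0 (ltr0n R 4)).
pose h := Num.min (d / 2) (1 / 2).
have h0 : 0 < h by rewrite lt_min !divr_gt0.
have hd : h < d by rewrite gt_min; apply/orP; left; lra.
have e1 : 0 < e * h ^+ 2 / 16 by rewrite !mulr_gt0// exprn_gt0.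
have [N HN] := curve_cost_small e1.
exists N => n Nn t; exists d => // s st sd.
have [|s1 st1 s1d] := @unitI_point_at_distance R t h.
  by rewrite h0 ge_min lexx orbT.
have [b1 b1P] := HN n Nn s1; have [b2 b2P] := HN n Nn t.
exists (fun i => (val s1 - val t)^-1 * (b1 i - b2 i)).
apply: (le_trans (cost_shift kker sigma a (slope c t s) (slope c t s1) _)).
have tt : `|val t - val t| < d by rewrite subrr normr0.
have := dP t t s t s1 st st1 tt sd tt; rewrite s1d => /(_ hd).
have := cost_difference kker sigma a (val s1 - val t)^-1 (c s1) (c t) b1 b2.
rewrite -/(slope c t s1) exprVn -real_normK ?num_real// s1d => C S.
have : 2 * (h ^+ 2)^-1 * (cost k sigma a [:: (1, c s1)] b1 +
   cost k sigma a [:: (1, c t)] b2) <=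
   2 * (h ^+ 2)^-1 * (e * h ^+ 2 / 16 + e * h ^+ 2 / 16).
  by rewrite ler_wpM2l ?lerD// mulr_ge0// invr_ge0 sqr_ge0.
have -> : 2 * (h ^+ 2)^-1 * (e * h ^+ 2 / 16 + e * h ^+ 2 / 16) = e / 4.
  by field; rewrite gt_eqF.
by move: C S; lra.
Qed.

(** Passing to the limit in the difference quotients transfers the bound on
bias and noise to the derivative of the smoothing error. *)
Lemma derivative_error_small (M V : R) (f : X -> R) (e : R) :
  rkhs_bounded k M f -> 0 <= V -> 0 < e ->
  exists N, forall n, (N <= n)%N ->
    forall (f' : unitI R -> R) (w' : 'I_n -> unitI R -> R),
    (forall t, is_derivI (f \o c) t (f' t)) ->
    (forall i t, is_derivI (weight k sigma a i \o c) t (w' i t)) ->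
    forall t, V * (\sum_i w' i t ^+ 2)
      + (\sum_i w' i t * f (a i) - f' t) ^+ 2 <= e.
Proof.
move=> fM V0 e0.
have C0 : 0 < M + V / sigma ^+ 2 + 1.
  by rewrite ltr_wpDl// addr_ge0 ?fM.1// divr_ge0// sqr_ge0.
have [N HN] := slope_cost_small (divr_gt0 e0 C0).
exists N => n Nn f' w' df dw t; have [d d0 dP] := HN n Nn t.
have PF := unitI_dnbhs_proper t.
pose E (s : unitI R) := V * (\sum_(i < n) diff_quot (weight k sigma a i \o c) t s ^+ 2)
  + (\sum_(i < n) diff_quot (weight k sigma a i \o c) t s * f (a i)
     - diff_quot (f \o c) t s) ^+ 2.
have cE : E s @[s --> t^'] --> V * (\sum_i w' i t ^+ 2)
      + (\sum_i w' i t * f (a i) - f' t) ^+ 2.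
  apply: cvgD.
    apply: cvgM; first exact: cvg_cst.
    apply: cvg_big => [|i _]; first exact: add_continuous.
    by under eq_cvg do rewrite expr2; rewrite expr2; apply: cvgM; exact: dw.
  under eq_cvg do rewrite expr2; rewrite expr2.
  have B : (\sum_(i < n) diff_quot (weight k sigma a i \o c) t s * f (a i)
     - diff_quot (f \o c) t s) @[s --> t^'] --> \sum_i w' i t * f (a i) - f' t.
    apply: cvgB; last exact: df.
    apply: cvg_big => [|i _]; first exact: add_continuous.
    by apply: cvgM; [exact: dw|exact: cvg_cst].
  exact: cvgM.
apply: (cvgr_to_le cE).
apply/nbhs_unitIP; exists d => // s sd st.
have [b bP] := dP s st sd.
have := error_small kker sigma_gt0 fM V0 (ltW e0) bP.
rewrite ev_slope; under eq_bigr => i _ do rewrite ev_slope.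
by under [X in _ + (X - _) ^+ 2 <= _]eq_bigr => i _ do rewrite ev_slope.
Qed.

End curve.

Lemma point_error_small (M V : R) (f : X -> R) (z : X) (e : R) :
  rkhs_bounded k M f -> 0 <= V -> 0 < e ->
  exists N, forall n, (N <= n)%N ->
    V * (\sum_(i < n) weight k sigma a i z ^+ 2)
      + (\sum_(i < n) weight k sigma a i z * f (a i) - f z) ^+ 2 <= e.
Proof.
move=> fM V0 e0.
have C0 : 0 < M + V / sigma ^+ 2 + 1.
  by rewrite ltr_wpDl// addr_ge0 ?fM.1// divr_ge0// sqr_ge0.
have [U Uz [N HN]] := point_cost_small z (divr_gt0 e0 C0).
exists N => n Nn; have [b bP] := HN n Nn z (nbhs_singleton Uz).
have := error_small kker sigma_gt0 fM V0 (ltW e0) bP.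
have ev1 g : ev g [:: (1, z)] = g z by rewrite ev_cons ev_nil mul1r addr0.
rewrite ev1; under eq_bigr => i _ do rewrite ev1.
by under [X in _ + (X - _) ^+ 2 <= _]eq_bigr => i _ do rewrite ev1.
Qed.

End cost_vanishes.

(** * Moments of the noise *)

Section orthogonal.
Context d (T : measurableType d) (R : realType) (P : {measure set T -> \bar R}).
Local Open Scope ereal_scope.

(** The theorem of Pythagoras in L^2. *)
Lemma integral_sqr_orthogonal (I : finType) (Y : I -> T -> R) (c : I -> R) :
  (forall i j, P.-integrable setT (fun w => (Y i w * Y j w)%:E)) ->
  (forall i j, i != j -> \int[P]_w (Y i w * Y j w)%:E = 0) ->
  \int[P]_w ((\sum_i c i * Y i w) ^+ 2)%R%:E
  = \sum_i (c i ^+ 2)%:E * \int[P]_w (Y i w ^+ 2)%R%:E.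
Proof.
move=> iY oY.
under eq_integral => w _.
  rewrite expr2 mulr_suml -sumEFin.
  under eq_bigr => i _.
    rewrite mulr_sumr -sumEFin.
    under eq_bigr => j _ do rewrite mulrACA EFinM.
    over.
  over.
have iZ i j : P.-integrable setT
    (fun w => (c i * c j)%:E * (Y i w * Y j w)%:E).
  by apply: integrableZl.
rewrite integral_sum//; last first.
  by move=> i; apply: integrable_sum => // j _; exact: iZ.
apply: eq_bigr => i _.
rewrite integral_sum// (bigD1 i)//= integralZl// big1 ?adde0.
  by rewrite expr2; congr (_ * _); apply: eq_integral => w _; rewrite expr2.
by move=> j ji; rewrite integralZl// oY ?mule0// eq_sym.
Qed.

Lemma integrable_mul_sqr (X Y : T -> R) :
  measurable_fun setT X -> measurable_fun setT Y ->
  P.-integrable setT (fun w => (X w ^+ 2)%:E) ->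
  P.-integrable setT (fun w => (Y w ^+ 2)%:E) ->
  P.-integrable setT (fun w => (X w * Y w)%:E).
Proof.
move=> mX mY iX iY; apply: (le_integrable _ _ _ (integrableD _ iX iY)) => //.
  by apply/measurable_EFinP; exact: measurable_funM.
move=> w _ /=; rewrite lee_fin [leRHS]ger0_norm; last by rewrite addr_ge0 ?sqr_ge0.
rewrite normrM -(real_normK (num_real (X w))) -(real_normK (num_real (Y w))).
have := sqr_ge0 (`|X w| - `|Y w|)%R.
have := sqr_ge0 (`|X w| + `|Y w|)%R.
by nra.
Qed.

End orthogonal.

Section normal.
Context (R : realType) (s : R) (s0 : s != 0).
Local Notation mu := (@lebesgue_measure R).
Local Notation N := (normal_prob 0 s).
Local Open Scope ereal_scope.

(** The density of the normal law is its Radon-Nikodym derivative, up to a null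
set. *)
Lemma ge0_integral_normal_prob (f : R -> \bar R) :
  measurable_fun setT f -> (forall x, 0 <= f x) ->
  \int[N]_x f x = \int[mu]_x (f x * (normal_pdf 0 s x)%:E).
Proof.
move=> mf f0.
have Nmu : N `<< mu := normal_prob_dominates 0 s.
rewrite -(@Radon_Nikodym_SigmaFinite.change_of_variables _ _ _ N mu Nmu)//.
have mrn := Radon_Nikodym_SigmaFinite.f_integrable Nmu.
have mp : measurable_fun setT (fun x => (normal_pdf 0 s x)%:E).
  exact: measurable_int (integrable_normal_pdf 0 s).
apply: ae_eq_integral => //.
- by apply: emeasurable_funM => //; exact: measurable_int mrn.
- exact: emeasurable_funM.
- apply: ae_eqe_mul2l; apply: integral_ae_eq => // A _ mA.
  by rewrite -Radon_Nikodym_SigmaFinite.f_integral.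
Qed.

Lemma normal_probN (A : set R) : measurable A -> N (-%R @^-1` A) = N A.
Proof.
move=> mA; rewrite /normal_prob.
transitivity (\int[mu]_(x in (-%R : _ -> measurableTypeR R) @^-1` A)
    ((fun x => (normal_pdf 0 s x)%:E) \o (-%R : _ -> measurableTypeR R)) x).
  apply: eq_integral => x _ /=.
  by rewrite normal_pdfE // /normal_fun !subr0 sqrrN.
rewrite -ge0_integral_pushforward//.
- by apply: eq_measure_integral => //= B mB BS; exact: lebesgue_measureN.
- apply: measurable_funTS; exact: measurable_int (integrable_normal_pdf 0 s).
- by move=> x _; rewrite lee_fin normal_pdf_ge0.
Qed.

(** u * exp(-2u) <= exp(-u) with u = x^2 / (4 s^2) dominates the second moment
by a multiple of the total mass of the normal law with deviation sqrt 2 * s. *)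
Lemma normal_second_moment_lty : \int[N]_x (x ^+ 2)%:E < +oo.
Proof.
pose s' := (Num.sqrt 2 * s)%R.
have s'0 : s' != 0%R by rewrite mulf_neq0// gt_eqF// sqrtr_gt0.
pose C := (4 * s ^+ 2 * (normal_peak s / normal_peak s'))%R.
have p0 := normal_peak_gt0 s0.
have p'0 := normal_peak_gt0 s'0.
have C0 : (0 <= C)%R.
  apply: mulr_ge0; first by rewrite mulr_ge0 ?sqr_ge0.
  by apply: divr_ge0; exact: ltW.
rewrite ge0_integral_normal_prob//; last 2 first.
- by apply/measurable_EFinP; exact: measurable_funX.
- by move=> x; rewrite lee_fin sqr_ge0.
have mp (t : R) : measurable_fun setT (fun x => (normal_pdf 0 t x)%:E).
  exact: measurable_int (integrable_normal_pdf 0 t).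
apply: (@le_lt_trans _ _ (\int[mu]_x (C%:E * (normal_pdf 0 s' x)%:E))).
  apply: ge0_le_integral => //.
  - by move=> x _; rewrite mule_ge0 ?lee_fin ?sqr_ge0 ?normal_pdf_ge0.
  - apply: emeasurable_funM => //.
      by apply/measurable_EFinP; exact: measurable_funX.
    exact: mp.
  - by apply: emeasurable_funM => //; exact: mp.
  - move=> x _; rewrite -!EFinM lee_fin !normal_pdfE//.
    rewrite /normal_fun !subr0.
    pose u := (x ^+ 2 / (4 * s ^+ 2))%R.
    have s20 : (0 < s ^+ 2)%R by rewrite exprn_even_gt0.
    have u0 : (0 <= u)%R by rewrite /u divr_ge0 ?sqr_ge0// mulr_ge0 ?sqr_ge0.
    have -> : (- x ^+ 2 / (s ^+ 2 *+ 2) = - u - u)%R.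
      by rewrite /u; field.
    have -> : (- x ^+ 2 / (s' ^+ 2 *+ 2) = - u)%R.
      by rewrite /u /s' exprMn sqr_sqrtr//; field.
    have -> : (x ^+ 2 = 4 * s ^+ 2 * u)%R by rewrite /u; field.
    have ue : (u * expR (- u) <= 1)%R.
      have := expR_ge1Dx u; have := expR_gt0 (- u)%R.
      have : (expR u * expR (- u) = 1)%R by rewrite -expRD subrr expR0.
      by nra.
    rewrite expRD /C.
    have -> : (4 * s ^+ 2 * (normal_peak s / normal_peak s') *
      (normal_peak s' * expR (- u)) =
      4 * s ^+ 2 * normal_peak s * expR (- u) * 1)%R.
      by field; rewrite gt_eqF.
    have -> : (4 * s ^+ 2 * u * (normal_peak s * (expR (- u) * expR (- u))) =
      4 * s ^+ 2 * normal_peak s * expR (- u) * (u * expR (- u)))%R by ring.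
    apply: ler_wpM2l => //; apply: mulr_ge0; last exact: expR_ge0.
    by apply: mulr_ge0; [rewrite mulr_ge0 ?sqr_ge0|exact: ltW].
rewrite ge0_integralZl//; last 2 first.
- exact: mp.
- by move=> x _; rewrite lee_fin normal_pdf_ge0.
by rewrite integral_normal_pdf mule1 ltry.
Qed.

Lemma integrable_normal_sqr : N.-integrable setT (fun x => (x ^+ 2)%:E).
Proof.
apply/integrableP; split.
  by apply/measurable_EFinP; exact: measurable_funX.
under eq_integral do rewrite gee0_abs ?lee_fin ?sqr_ge0//.
exact: normal_second_moment_lty.
Qed.

Lemma integrable_normal_id : N.-integrable setT EFin.
Proof.
have i1 : N.-integrable setT (fun x : R => (1 ^+ 2)%:E).
  by apply: finite_measure_integrable_cst.
have := integrable_mul_sqr _ _ integrable_normal_sqr i1.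
under [in X in _ -> _ -> X]eq_fun do rewrite mulr1.
by apply.
Qed.

Lemma normal_mean0 : \int[N]_x x%:E = 0.
Proof.
have E : \int[N]_x x%:E = - \int[N]_x x%:E.
  rewrite -integralN/=; last first.
    exact: integrable_add_def integrable_normal_id.
  transitivity (\int[pushforward N (-%R : _ -> measurableTypeR R)]_x x%:E).
    by apply: eq_measure_integral => //= A mA _; rewrite /pushforward normal_probN.
  rewrite integral_pushforward//=.
  exact: integrableN integrable_normal_id.
have : \int[N]_x x%:E \is a fin_num by exact: integrable_fin_num integrable_normal_id.
move: E; case: (\int[N]_x x%:E) => // r; rewrite -EFinN => -[rN] _.
by congr EFin; lra.
Qed.

End normal.

Lemma big_option (R : Type) (idx : R) (op : Monoid.com_law idx) (I : finType)
    (F : option I -> R) :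
  \big[op/idx]_o F o = op (F None) (\big[op/idx]_i F (Some i)).
Proof.
rewrite (bigD1 None)//= (reindex_omap Some id)/=; last by case.
by congr (op _ _); apply: eq_bigl => i; rewrite eqxx.
Qed.

Section noise_moments.
Context (R : realType) d (T : measurableType d) (P : probability T R).
Variables (sigma : R) (zeta : nat -> {RV P >-> R}).
Hypothesis sigma0 : sigma != 0.
Hypothesis zeta_iid : iid_normal 0 sigma zeta.
Local Notation N := (normal_prob 0 sigma).
Local Open Scope ereal_scope.

(* normal_prob is a measure for this display of the Borel sets of R. *)
Local Notation RR := (measurableTypeR R).

Lemma noise_measurable i : measurable_fun setT (zeta i : T -> RR).
Proof. by have h : measurable_fun setT (zeta i : T -> R) by []; exact: h. Qed.

Lemma noise_law i (A : set RR) : measurable A -> P (zeta i @^-1` A) = N A.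
Proof. by move=> mA; have /(_ mA) := zeta_iid.2 i A. Qed.

Lemma noise_second_moment i :
  \int[P]_w (zeta i w ^+ 2)%:E = \int[N]_x (x ^+ 2)%:E.
Proof.
transitivity (\int[pushforward P (zeta i : T -> RR)]_x (x ^+ 2)%:E).
  rewrite ge0_integral_pushforward//; first exact: noise_measurable.
  - by apply/measurable_EFinP; exact: measurable_funX.
  - by move=> x _; rewrite lee_fin sqr_ge0.
by apply: eq_measure_integral => [|? A mA _]; [exact: noise_measurable|exact: noise_law].
Qed.

Lemma integrable_noise_sqr i : P.-integrable setT (fun w => (zeta i w ^+ 2)%:E).
Proof.
apply/integrableP; split.
  by apply/measurable_EFinP; apply: measurable_funX; exact: noise_measurable.
under eq_integral do rewrite gee0_abs ?lee_fin ?sqr_ge0//.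
by rewrite noise_second_moment; exact: normal_second_moment_lty.
Qed.

Lemma integrable_noise_mul i j :
  P.-integrable setT (fun w => (zeta i w * zeta j w)%:E).
Proof.
apply: integrable_mul_sqr; [exact: noise_measurable..| |];
  exact: integrable_noise_sqr.
Qed.

Lemma integrable_noise i : P.-integrable setT (fun w => (zeta i w)%:E).
Proof.
have i1 : P.-integrable setT (fun w : T => (1 ^+ 2)%:E : \bar R).
  by apply: finite_measure_integrable_cst.
have := integrable_mul_sqr _ _ (integrable_noise_sqr i) i1.
under [in X in _ -> _ -> X]eq_fun do rewrite mulr1.
by apply; [exact: noise_measurable|exact: measurable_cst].
Qed.

Lemma noise_mean0 i : \int[P]_w (zeta i w)%:E = 0.
Proof.
rewrite -(normal_mean0 sigma0).
transitivity (\int[pushforward P (zeta i : T -> RR)]_x x%:E).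
  rewrite integral_pushforward//; first exact: noise_measurable.
  exact: integrable_noise.
by apply: eq_measure_integral => [|? A mA _]; [exact: noise_measurable|exact: noise_law].
Qed.

Lemma noise_joint_law i j (A B : set RR) : i != j -> measurable A -> measurable B ->
  P ((zeta i @^-1` A) `&` (zeta j @^-1` B)) = N A * N B.
Proof.
move=> ij mA mB.
pose C m := if m == i then A else B.
have mC m : measurable (C m) by rewrite /C; case: ifP.
have := zeta_iid.1 [fset i; j]%fset C mC.
rewrite big_fsetU1 ?inE//= big_seq_fset1 /C eqxx eq_sym (negbTE ij).
rewrite !noise_law// => <-; congr (P _); apply/seteqP; split => w /=.
- by move=> [wA wB] m /=; rewrite !inE => /orP[]/eqP ->;
    rewrite ?eqxx// eq_sym (negbTE ij).
- move=> h; split; first by have := h i; rewrite /= !inE eqxx; apply.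
  by have := h j; rewrite /= !inE eqxx orbT eq_sym (negbTE ij); apply.
Qed.

(** The pair law is the product law by uniqueness of product measures, and
the first factor of the product integrates to zero. *)
Lemma noise_uncorrelated i j : i != j ->
  \int[P]_w (zeta i w * zeta j w)%:E = 0.
Proof.
move=> ij.
pose f := fun w => (zeta i w, zeta j w) : (RR * RR)%type.
have mf : measurable_fun setT f.
  by apply: measurable_fun_pair; exact: noise_measurable.
pose F : {RV P >-> (RR * RR)%type} :=
  HB.pack f (isMeasurableFun.Build _ _ _ _ _ mf).
pose g (p : RR * RR) := (p.1 * p.2)%:E.
have mg : measurable_fun setT g.
  by apply/measurable_EFinP; apply: measurable_funM;
    [exact: measurable_fst|exact: measurable_snd].
have law X : measurable X -> (N \x N) X = distribution P F X.
  apply: product_measure_unique => A B mA mB.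
  by rewrite -(noise_joint_law ij mA mB).
have ig : (N \x N).-integrable setT g.
  apply/integrableP; split => //.
  rewrite (eq_measure_integral (distribution P F)); last by move=> A mA _; exact: law.
  have := integrable_noise_mul i j => /integrableP[_].
  by rewrite ge0_integral_distribution//; exact: measurableT_comp.
transitivity (\int[distribution P F]_p g p).
  by rewrite integral_distribution//; exact: integrable_noise_mul.
transitivity (\int[N \x N]_p g p).
  by apply: eq_measure_integral => A mA _; exact/esym/law.
rewrite -integral12_prod_meas1//.
apply: integral0_eq => x _.
rewrite /fubini_F /g/=.
under eq_integral do rewrite EFinM.
by rewrite integralZl// ?normal_mean0 ?mule0//; exact: integrable_normal_id.
Qed.

(** The noise and the constant 1 form an orthogonal family in L^2. *)
Lemma affine_noise_second_moment n (c : 'I_n -> R) (b : R) :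
  \int[P]_w ((\sum_i c i * zeta i w + b) ^+ 2)%:E
  = (fine (\int[N]_x (x ^+ 2)%:E) * (\sum_i c i ^+ 2) + b ^+ 2)%:E.
Proof.
pose Y (o : option 'I_n) : T -> R := if o is Some i then zeta i else cst 1%R.
pose c' (o : option 'I_n) := if o is Some i then c i else b.
have Efin : \int[N]_x (x ^+ 2)%:E \is a fin_num.
  exact: integrable_fin_num (integrable_normal_sqr sigma0).
transitivity (\int[P]_w ((\sum_o c' o * Y o w) ^+ 2)%R%:E).
  apply: eq_integral => w _; congr ((_ ^+ 2)%:E).
  by rewrite big_option/= addrC mulr1.
rewrite integral_sqr_orthogonal.
- have E1 : \int[P]_w (cst 1%R w ^+ 2)%:E = 1.
    under eq_integral do rewrite /= expr1n.
    rewrite integral_cst ?mul1e; first exact: probability_setT.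
    exact: measurableT.
  rewrite big_option/= E1 mule1 addeC.
  rewrite EFinD; congr (_ + _); rewrite mulr_sumr -sumEFin.
  by apply: eq_bigr => i _; rewrite noise_second_moment [in RHS]EFinM fineK// muleC.
- move=> [i|] [j|] /=.
  + exact: integrable_noise_mul.
  + by under eq_fun do rewrite mulr1; exact: integrable_noise.
  + by under eq_fun do rewrite mul1r; exact: integrable_noise.
  + exact: finite_measure_integrable_cst.
- move=> [i|] [j|] //= ij.
  + by apply: noise_uncorrelated; apply: contra ij => /eqP/val_inj ->.
  + by under eq_integral do rewrite mulr1; exact: noise_mean0.
  + by under eq_integral do rewrite mul1r; exact: noise_mean0.
Qed.

End noise_moments.

(** * Energy of the smoothing error *)

Section sup_norm_bound.
Context {R : realType} {Z0 L : finType} (phi : L -> bool -> Z0).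
Local Notation mu := (@lebesgue_measure R).

(** A quadratic quantity that dominates the uniform norm of G, and whose
expectation is a sum of integrals of mean squared errors. *)
Definition energy (G : cw R phi -> R) (G' : L -> unitI R -> R) : \bar R :=
  (\sum_(v : Z0) (G (vertex phi v) ^+ 2)%:E +
   \sum_(l : L) \int[mu]_(x in `[0%R, 1%R]) (G' l (clampI x) ^+ 2)%:E)%E.

(** A point of a cell is reached from a vertex by integrating the derivative
along the cell. *)
Lemma sup_norm_le_energy (G : cw R phi -> R) (G' : L -> unitI R -> R) (del : R) :
  0 < del -> (forall l, continuous (G' l)) ->
  (forall l t, is_derivI (G \o cell phi l) t (G' l t)) ->
  (sup_norm G <= ((#|Z0| + #|L|)%:R * del)%:E + del^-1%:E * energy G G')%E.
Proof.
move=> d0 cG' dG; rewrite /energy.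
under [X in (_ + _ * (_ + X))%E]eq_bigr => l _ do rewrite unitI_integral_sqr//.
rewrite !sumEFin -EFinD.
apply: ge_ereal_sup => _ [z _ <-]; rewrite lee_fin.
have A0 (v : Z0) : 0 <= `|G (vertex phi v)| by [].
have B0 (l : L) : 0 <= \int[mu]_(x in `[0, 1]) `|G' l (clampI x)|.
  by apply: Rintegral_ge0.
apply: (@le_trans _ _ (\sum_v `|G (vertex phi v)| +
   \sum_l \int[mu]_(x in `[0, 1]) `|G' l (clampI x)|)).
  have Av (v : Z0) : `|G (vertex phi v)| <= \sum_v `|G (vertex phi v)|.
    by rewrite (bigD1 v)//= lerDl sumr_ge0.
  have [[v ->]|[l [t ->]]] := cw_cases z.
    by rewrite -[leLHS]addr0 lerD// sumr_ge0.
  have := unitI_increment_le t (dG l) (cG' l).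
  rewrite /comp cell0 => h.
  rewrite -[G (cell phi l t)](subrK (G (vertex phi (phi l false)))) addrC.
  apply: (le_trans (ler_normD _ _)); apply: lerD; first exact: Av.
  by apply: (le_trans h); rewrite (bigD1 l)//= lerDl sumr_ge0.
rewrite natrD mulrDl mulrDr addrACA; apply: lerD.
  have -> : #|Z0|%:R * del = \sum_(v : Z0) del.
    by rewrite sumr_const mulr_natl.
  rewrite mulr_sumr -big_split/=; apply: ler_sum => v _.
  exact: norm_le_add_sqr.
have -> : #|L|%:R * del = \sum_(l : L) del by rewrite sumr_const mulr_natl.
rewrite mulr_sumr -big_split/=; apply: ler_sum => l _.
exact: clamp_Rint_norm_le.
Qed.

End sup_norm_bound.

Section expected_energy.
Context (R : realType) d (T : measurableType d) (P : probability T R).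
Variables (sigma : R) (zeta : nat -> {RV P >-> R}).
Hypothesis sigma0 : sigma != 0.
Hypothesis zeta_iid : iid_normal 0 sigma zeta.
Local Notation mu := (@lebesgue_measure R).
Local Notation C := (fine (\int[normal_prob 0 sigma]_x (x ^+ 2)%:E)).
Variables (n : nat) (c : 'I_n -> unitI R -> R) (b : unitI R -> R).
Hypothesis cc : forall i, continuous (c i).
Hypothesis bc : continuous b.

(* The integrand extended by zero outside [0, 1], as Tonelli's theorem is about
   integrals over the whole product space. *)
Let H (p : T * measurableTypeR R) : \bar R :=
  (((\sum_i c i (clampI p.2) * zeta i p.1 + b (clampI p.2)) ^+ 2)%:E
   * (\1_`[0%R, 1%R] p.2)%:E)%E.

Let HE w : (\int[mu]_(x in `[0%R, 1%R])
  ((\sum_i c i (clampI x) * zeta i w + b (clampI x)) ^+ 2)%:E =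
  \int[mu]_x H (w, x))%E.
Proof. by rewrite integral_mkcond epatch_indic. Qed.

Let mH : measurable_fun setT H.
Proof.
have mclamp (g : unitI R -> R) : continuous g ->
    measurable_fun setT (fun p : T * measurableTypeR R => g (clampI p.2)).
  move=> gc; apply: (measurableT_comp (f := fun x => g (clampI x))).
    exact: clamp_measurable gc.
  exact: measurable_snd.
apply: emeasurable_funM; apply/measurable_EFinP.
  apply: measurable_funX; apply: measurable_funD; last exact: mclamp.
  apply: measurable_sum => i; apply: measurable_funM; first exact: mclamp.
  apply: (measurableT_comp (f := zeta i : T -> R)); first exact: measurable_funP.
  exact: measurable_fst.
apply: (measurableT_comp (f := \1_`[0%R, 1%R] : R -> R)).
  exact: measurable_indic.
exact: measurable_snd.
Qed.

Let H0 p : (0 <= H p)%E.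
Proof. by rewrite mule_ge0// lee_fin ?sqr_ge0// indicE. Qed.

Lemma cell_energy_measurable : measurable_fun setT (fun w =>
  \int[mu]_(x in `[0%R, 1%R])
    ((\sum_i c i (clampI x) * zeta i w + b (clampI x)) ^+ 2)%:E)%E.
Proof.
under eq_fun do rewrite HE.
exact: measurable_fun_fubini_tonelli_F.
Qed.

Lemma expected_cell_energy_le (e : R) :
  (forall t, C * (\sum_i c i t ^+ 2) + b t ^+ 2 <= e) ->
  (\int[P]_w \int[mu]_(x in `[0%R, 1%R])
    ((\sum_i c i (clampI x) * zeta i w + b (clampI x)) ^+ 2)%:E <= e%:E)%E.
Proof.
move=> He.
under eq_integral do rewrite HE.
rewrite fubini_tonelli//.
apply: (@le_trans _ _ (\int[mu]_(x in `[0%R, 1%R]) (cst e%:E) x)%E).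
  rewrite [leRHS]integral_mkcond; apply: ge0_integral_mono.
    by move=> x; apply: integral_ge0.
  move=> x; rewrite patchE /H/=.
  under eq_integral do rewrite muleC.
  rewrite ge0_integralZl//; last 2 first.
  - apply/measurable_EFinP; apply: measurable_funX; apply: measurable_funD => //.
    by apply: measurable_sum => i; apply: measurable_funM.
  - by move=> w _; rewrite lee_fin sqr_ge0.
  rewrite (affine_noise_second_moment sigma0 zeta_iid) indicE.
  by case: ifP => // _; rewrite ?mul0e// mul1e lee_fin.
by rewrite integral_cst// [X in (_ * X)%E]lebesgue_unitI mule1.
Qed.

End expected_energy.

Section smoothing_error.
Context {R : realType} {Z0 L : finType} (phi : L -> bool -> Z0).
Variables (k : cw R phi -> cw R phi -> R) (kker : is_kernel k).
Hypothesis Zconn : connected [set: cw R phi].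
Hypothesis kcont : continuous (fun p : cw R phi * cw R phi => k p.1 p.2).
Hypothesis kC2 : forall l, C_II 2 (fun p => k (cell phi l p.1) (cell phi l p.2)).
Variables (M : R) (f : cw R phi -> R) (fM : rkhs_bounded k M f).
Variables (a : nat -> cw R phi) (adense : dense (range a)).
Context (d : measure_display) (T : measurableType d) (P : probability T R).
Variables (sigma : R) (sigma_gt0 : 0 < sigma).
Variables (zeta : nat -> {RV P >-> R}) (zeta_iid : iid_normal 0 sigma zeta).
Local Notation mu := (@lebesgue_measure R).
Local Notation C := (fine (\int[normal_prob 0 sigma]_x (x ^+ 2)%:E)).

Local Notation fhat n w :=
  (gaussian_smoothing k sigma a n (fun i => f (a i) + zeta i w)).

Let visits (U : set (cw R phi)) : open U -> U !=set0 ->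
  infinite_set [set i | U (a i)].
Proof. exact: (dense_seq_infinitely_often (@cw_accessible R Z0 L phi)). Qed.

Let sigma0 : sigma != 0. Proof. by rewrite gt_eqF. Qed.

Let C0 : 0 <= C.
Proof. by rewrite fine_ge0// integral_ge0// => x _; rewrite lee_fin sqr_ge0. Qed.

Let errE n w z : fhat n w z - f z =
  \sum_(i < n) weight k sigma a i z * zeta i w
  + (\sum_(i < n) weight k sigma a i z * f (a i) - f z).
Proof.
rewrite gaussian_smoothingE addrA -big_split; congr (_ - _).
by apply: eq_bigr => i _ /=; rewrite mulrDr addrC.
Qed.

(** The smoothed function is a combination of the weights, which lie in the span,
with random coefficients; so one choice of derivatives of the weights serves
all outcomes w. *)
Lemma smoothing_derivatives :
  exists (f' : L -> unitI R -> R) (w' : forall n, 'I_n -> L -> unitI R -> R),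
  [/\ forall l, continuous (f' l),
      forall l t, is_derivI (f \o cell phi l) t (f' l t),
      forall n (i : 'I_n) l, continuous (w' n i l) &
      forall n (i : 'I_n) l t,
        is_derivI (weight k sigma a i \o cell phi l) t (w' n i l t)].
Proof.
have D (g : cw R phi -> R) : (exists M', rkhs_bounded k M' g) ->
    exists g' : L -> unitI R -> R, (forall l, continuous (g' l)) /\
      (forall l t, is_derivI (g \o cell phi l) t (g' l t)).
  move=> [M' gM].
  have H l : exists g' : unitI R -> R, continuous g' /\
      (forall t, is_derivI (g \o cell phi l) t (g' t)).
    by have [g' g'c g'd] := rkhs_bounded_C1 kker (kC2 l) gM; exists g'.
  have [g' g'P] := choice H.
  by exists g'; split => l; [exact: (g'P l).1|exact: (g'P l).2].
have [f' [f'c f'd]] := D f (ex_intro _ M fM).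
have W (p : {n & 'I_n}) := D _ (weight_bounded kker sigma a (projT2 p)).
have [w' w'P] := choice W.
exists f', (fun n i => w' (existT _ n i)); split => //.
- by move=> n i l; exact: (w'P (existT _ n i)).1.
- by move=> n i l t; exact: (w'P (existT _ n i)).2.
Qed.

(** The error and its derivative are both of the form noise plus bias, linear in
the noise; so their second moments are those bounded by the cost, at every
vertex and uniformly along every cell. *)
Lemma smoothing_error_energy :
  exists (f' : L -> unitI R -> R) (s' : nat -> T -> L -> unitI R -> R),
  [/\ (forall l, continuous (f' l)) /\
      (forall l t, is_derivI (f \o cell phi l) t (f' l t)),
      (forall n w l, continuous (s' n w l)) /\
      (forall n w l t, is_derivI (fhat n w \o cell phi l) t (s' n w l t)),
      forall n l, measurable_fun setT (fun w =>
        \int[mu]_(x in `[0%R, 1%R]) ((s' n w l (clampI x) - f' l (clampI x)) ^+ 2)%:E)%E &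
      forall e, 0 < e -> exists N, forall n, (N <= n)%N ->
        (forall v, (\int[P]_w ((fhat n w (vertex phi v) - f (vertex phi v)) ^+ 2)%:E <= e%:E)%E) /\
        (forall l, (\int[P]_w
          \int[mu]_(x in `[0%R, 1%R])
            ((s' n w l (clampI x) - f' l (clampI x)) ^+ 2)%:E <= e%:E)%E)].
Proof.
have [f' [w' [f'c f'd w'c w'd]]] := smoothing_derivatives.
pose s' n w l t := \sum_(i < n) (f (a i) + zeta i w) * w' n i l t.
pose b n l t := \sum_(i < n) w' n i l t * f (a i) - f' l t.
have bc n l : continuous (b n l).
  apply: sub_continuousI; last exact: f'c.
  rewrite (_ : (fun t => _) = fun t => \sum_(i < n) f (a i) * w' n i l t).
    by apply: lincomb_continuousI => i; exact: w'c.
  by apply/funext => t; apply: eq_bigr => i _; rewrite mulrC.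
have eE n w l t : s' n w l t - f' l t =
    \sum_(i < n) w' n i l t * zeta i w + b n l t.
  rewrite /s' /b addrA -big_split; congr (_ - _).
  by apply: eq_bigr => i _ /=; ring.
exists f', s'; split => //.
- split=> n w l; first by apply: lincomb_continuousI => i; exact: w'c.
  move=> t; rewrite (_ : _ \o _ = fun t =>
      \sum_(i < n) (f (a i) + zeta i w) * (weight k sigma a i \o cell phi l) t).
    by apply: (is_derivI_lincomb (c' := fun i => w' n i l)) => i; exact: w'd.
  apply/funext => u; rewrite /= gaussian_smoothingE.
  by apply: eq_bigr => i _; rewrite mulrC.
- move=> n l; under eq_fun => w do under eq_integral => x _ do rewrite eE.
  by apply: (cell_energy_measurable zeta (c := fun i => w' n i l) (b := b n l)) =>
    [i|]; [exact: w'c|exact: bc].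
- move=> e e0.
  have Hv v := point_error_small kker kcont sigma_gt0 visits (vertex phi v) fM C0 e0.
  have [Nv NvP] := choice Hv.
  have Hl l := derivative_error_small kker kcont sigma_gt0 visits
    (@cell_continuous R Z0 L phi l) (kC2 l) fM C0 e0.
  have [Nl NlP] := choice Hl.
  exists (maxn (\max_v Nv v) (\max_l Nl l)) => n.
  rewrite geq_max => /andP[/bigmax_leqP Nvn /bigmax_leqP Nln]; split.
  + move=> v; under eq_integral => w _ do rewrite errE.
    rewrite (affine_noise_second_moment sigma0 zeta_iid) lee_fin.
    exact: (NvP v n (Nvn v isT)).
  + move=> l; under eq_integral => w _ do under eq_integral => x _ do rewrite eE.
    apply: (expected_cell_energy_le sigma0 zeta_iid (c := fun i => w' n i l)).
    * by move=> i; exact: w'c.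
    * exact: bc.
    * move=> t; exact: (NlP l n (Nln l isT) (f' l) (fun i => w' n i l) (f'd l)
        (fun i => w'd n i l) t).
Qed.

End smoothing_error.

Theorem theorem21 (R : realType)
    (Z0 L : finType) (phi : L -> bool -> Z0)
    (Zconn : connected [set: cw R phi])
    (k : cw R phi -> cw R phi -> R)
    (kker : is_kernel k)
    (kcont : continuous (fun p : cw R phi * cw R phi => k p.1 p.2))
    (kdiff : kernel_differentiable 4 k)
    (kJ : (entropy_integral (dk k) < +oo)%E)
    (f : cw R phi -> R) (frkhs : in_rkhs k f)
    (a : nat -> cw R phi) (adense : dense (range a))
    (d : measure_display) (T : measurableType d) (P : probability T R)
    (sigma : R) (sigma_gt0 : 0 < sigma)
    (zeta : nat -> {RV P >-> R}) (zeta_iid : iid_normal 0 sigma zeta) :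
  let fhat (n : nat) (w : T) : cw R phi -> R :=
    gaussian_smoothing k sigma a n (fun i => f (a i) + zeta i w) in
  ((fun n : nat => \int[P]_w sup_norm (fun t => (fhat n w t - f t)%R))%E
     @ \oo --> 0%E) /\
  (forall l : L,
    (fun n : nat => \int[P]_w
       (`|variationI (fun t => fhat n w (cell phi l t))
          - variationI (fun t => f (cell phi l t))| ^+ 2))%E
      @ \oo --> 0%E).
Proof.
move=> fhat.
have kC2 l : C_II 2 (fun p => k (cell phi l p.1) (cell phi l p.2)).
  by do 2 apply: C_II_pred; exact: kdiff.1.
have [M fM] := in_rkhs_bounded kker frkhs.
have [f' [s' [[f'c f'd] [s'c s'd] s'm small]]] :=
  smoothing_error_energy kker Zconn kcont kC2 fM adense sigma_gt0 zeta_iid.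
have to0 (u : nat -> \bar R) : (forall n, 0 <= u n)%E ->
    (forall e : R, 0 < e -> exists N, forall n, (N <= n)%N -> (u n <= e%:E)%E) ->
    u @ \oo --> 0%E.
  move=> u0 H; apply/fine_cvgP; split.
    have [N HN] := H 1 ltr01; exists N => // n /= Nn.
    by rewrite ge0_fin_numE//; apply: le_lt_trans (HN n Nn) (ltry _).
  apply/cvgrPdist_le => e e0; have [N HN] := H e e0; exists N => // n /= Nn.
  rewrite sub0r normrN ger0_norm ?fine_ge0//.
  rewrite -lee_fin fineK; first exact: HN.
  by rewrite ge0_fin_numE//; apply: le_lt_trans (HN n Nn) (ltry _).
split=> [|l]; last first.
  apply: to0 => [n|e e0].
    by apply: integral_ge0 => w _; rewrite expe_ge0.
  have [N HN] := small e e0; exists N => n Nn.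
  apply: le_trans ((HN n Nn).2 l); apply: ge0_integral_mono => w.
    by rewrite expe_ge0.
  apply: variationI_dist_sqr_le; [exact: s'c|exact: f'c| |].
  - by move=> t; exact: s'd.
  - by move=> t; exact: f'd.
pose K : R := (#|Z0| + #|L|)%:R.
have K0 : 0 <= K by rewrite ler0n.
have K1 : 0 < K + 1 by rewrite ltr_wpDl.
have sup0 (g : cw R phi -> R) : (0 <= sup_norm g)%E.
  apply: (@le_trans _ _ `|g (a 0%N)|%:E); first by rewrite lee_fin.
  by apply: ereal_sup_ubound; exists (a 0%N).
apply: to0 => [n|e e0]; first by apply: integral_ge0 => w _; exact: sup0.
(* With this del the final bound is e K / (K + 1), at most e. *)
pose del := e / (2 * (K + 1)).
have d0 : 0 < del by rewrite divr_gt0// mulr_gt0.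
have [N HN] := small (del ^+ 2) (exprn_gt0 _ d0).
exists N => n Nn; have [Ev El] := HN n Nn.
pose G w z := fhat n w z - f z.
pose e' w l t := s' n w l t - f' l t.
have sup_le w : (sup_norm (G w) <=
    (K * del)%:E + del^-1%:E * energy (G w) (e' w))%E.
  apply: sup_norm_le_energy => // l.
    by apply: sub_continuousI; [exact: s'c|exact: f'c].
  by move=> t; apply: is_derivI_sub; [exact: s'd|exact: f'd].
have Gm v : measurable_fun setT (fun w => (G w (vertex phi v) ^+ 2)%:E).
  apply/measurable_EFinP; apply: measurable_funX.
  rewrite /G /fhat; under eq_fun do rewrite gaussian_smoothingE.
  apply: measurable_funB => //; apply: measurable_sum => i.
  apply: measurable_funM => //; apply: measurable_funD => //.
have enm : measurable_fun setT (fun w => energy (G w) (e' w)).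
  by apply: emeasurable_funD; apply: emeasurable_sum => // l; exact: s'm.
have i0 l w : (0 <= \int[lebesgue_measure]_(x in `[0%R, 1%R])
    (e' w l (clampI x) ^+ 2)%:E)%E.
  by apply: integral_ge0 => x _; rewrite lee_fin sqr_ge0.
have en0 w : (0 <= energy (G w) (e' w))%E.
  apply: adde_ge0; apply: sume_ge0 => // v _.
  by rewrite lee_fin sqr_ge0.
have Een : (\int[P]_w energy (G w) (e' w) <= (K * del ^+ 2)%:E)%E.
  rewrite /energy ge0_integralD//; last 4 first.
  - by move=> w _; apply: sume_ge0 => v _; rewrite lee_fin sqr_ge0.
  - exact: emeasurable_sum.
  - by move=> w _; apply: sume_ge0 => l _.
  - by apply: emeasurable_sum => l; exact: s'm.
  rewrite ge0_integral_sum//; last by move=> v w _; rewrite lee_fin sqr_ge0.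
  rewrite ge0_integral_sum//; last by move=> l; exact: s'm.
  rewrite /K natrD mulrDl EFinD; apply: leeD.
    rewrite mulr_natl -sumr_const -sumEFin.
    by apply: lee_sum => v _; exact: Ev.
  rewrite mulr_natl -sumr_const -sumEFin.
  by apply: lee_sum => l _; exact: El.
apply: (@le_trans _ _
  (\int[P]_w ((K * del)%:E + del^-1%:E * energy (G w) (e' w)))%E).
  by apply: ge0_integral_mono => w; [exact: sup0|exact: sup_le].
rewrite ge0_integralD//; last 3 first.
- by move=> w _; rewrite lee_fin mulr_ge0// ltW.
- by move=> w _; rewrite mule_ge0// lee_fin invr_ge0 ltW.
- exact: emeasurable_funM.
rewrite integral_cst// [X in (_ * X + _)%E]probability_setT mule1 ge0_integralZl//; last first.
  by rewrite lee_fin invr_ge0 ltW.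
apply: (@le_trans _ _ ((K * del)%:E + del^-1%:E * (K * del ^+ 2)%:E)%E).
  by apply: leeD2l; apply: lee_wpmul2l => //; rewrite lee_fin invr_ge0 ltW.
rewrite -EFinM -EFinD lee_fin.
have -> : K * del + del^-1 * (K * del ^+ 2) = e * (K / (K + 1)).
  by rewrite /del; field; rewrite !gt_eqF.
by rewrite ler_piMr ?(ltW e0)// ler_pdivrMr// mul1r lerDl.
Qed.
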